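(* Let $m\ge 1$, $1\le p<\infty$, let $X$ be any one of the four sets $\widetilde{S}^{m,p}$, $E^{m,p}$, $S_0^{m,p}$, $S^{m,p}$, and let $U\subset X$. Then $U$ is totally bounded in $(X,d_p)$ if and only if $U$ is relatively compact in $(X,d_p)$, and this is equivalent to the conjunction of the two conditions (i) $U$ is uniformly $p$-mean bounded; and (ii) $U$ is $p$-mean equi-left-continuous.
   Context: $H$ is the Hausdorff metric on nonempty closed subsets of $\mathbb{R}^m$ (Euclidean distance): $H(A,B)=\max\{\sup_{a\in A}\inf_{b\in B}d(a,b),\ \sup_{b\in B}\inf_{a\in A}d(a,b)\}$ (possibly $+\infty$). A fuzzy set on $\mathbb{R}^m$ is a function $u:\mathbb{R}^m\to[0,1]$; its cuts are $[u]_\alpha=\{x: u(x)\ge\alpha\}$ for $\alpha\in(0,1]$ and $[u]_0=\overline{\{x: u(x)>0\}}$. $F_B(\mathbb{R}^m)^p$ is the set of fuzzy sets $u$ on $\mathbb{R}^m$ that are normal ($u(x_0)=1$ for some $x_0$), upper semi-continuous, and satisfy $\left(\int_0^1 H([u]_\alpha,\{0\})^p\,d\alpha\right)^{1/p}<+\infty$, where $0$ is the origin. The metric is $d_p(u,v)=\left(\int_0^1 H([u]_\alpha,[v]_\alpha)^p\,d\alpha\right)^{1/p}$. Subsets of $F_B(\mathbb{R}^m)^p$: - $E^{m,p}$: those $u$ that are fuzzy convex, i.e. $u(\lambda x+(1-\lambda)y)\ge\min\{u(x),u(y)\}$ for all $x,y\in\mathbb{R}^m$, $\lambda\in[0,1]$;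 - $S_0^{m,p}$: those $u$ with $u(\lambda y)\ge u(y)$ for all $y\in\mathbb{R}^m$, $\lambda\in[0,1]$; - $S^{m,p}$: those $u$ for which there is $x\in\mathbb{R}^m$ with $u(\lambda y+(1-\lambda)x)\ge u(y)$ for all $y\in\mathbb{R}^m$, $\lambda\in[0,1]$; - $\widetilde{S}^{m,p}$: those $u$ such that for every $\alpha\in(0,1]$ there is $x_\alpha\in[u]_\alpha$ such that for all $y\in[u]_\alpha$ the segment $\overline{x_\alpha y}$ is contained in $[u]_\alpha$. A set $U\subset F_B(\mathbb{R}^m)^p$ is uniformly $p$-mean bounded if there is $M>0$ with $d_p(u,\widehat{0})\le M$ for all $u\in U$, where $\widehat 0$ is the characteristic function of $\{0\}$. $U$ is $p$-mean equi-left-continuous if for every $\varepsilon>0$ there is $\delta>0$ such that for all $0\le h<\delta$ and all $u\in U$, $\left(\int_h^1 H([u]_\alpha,[u]_{\alpha-h})^p\,d\alpha\right)^{1/p}<\varepsilon$. A subset of a metric space $X$ is relatively compact in $X$ if its closure in $X$ is compact. *)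

(* Defs.v *)
From HB Require Import structures.
From mathcomp Require Import all_boot all_order all_algebra.
From mathcomp Require Import all_classical all_reals all_analysis.
From mathcomp Require Import measurable_realfun lra.

Set Implicit Arguments.
Unset Strict Implicit.
Unset Printing Implicit Defensive.

Import Order.TTheory GRing.Theory Num.Theory.
Import numFieldNormedType.Exports.

Local Open Scope classical_set_scope.
Local Open Scope ring_scope.

Section euclid.
Context {R : realType} {m : nat}.
Implicit Types (x y z : 'rV[R]_m) (A B C : set 'rV[R]_m).

(* The norm of the library on 'rV[R]_m is the sup norm; it induces the same
   topology as the Euclidean distance, but a different Hausdorff metric. *)
Definition eucl_dist x y : R := Num.sqrt (\sum_i (x ord0 i - y ord0 i) ^+ 2).

Definition hausdorff_dist A B : \bar R :=
  Order.max
    (ereal_sup [set ereal_inf [set (eucl_dist a b)%:E | b in B] | a in A])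
    (ereal_sup [set ereal_inf [set (eucl_dist a b)%:E | a in A] | b in B]).

Definition alpha_cut (u : 'rV[R]_m -> R) (a : R) : set 'rV[R]_m :=
  if a == 0 then closure [set x | 0 < u x] else [set x | a <= u x].

End euclid.

Definition upper_semicontinuous {R : realType} {T : topologicalType}
    (f : T -> R) :=
  forall x a, f x < a -> \forall y \near x, f y < a.

Section fuzzy.
Context {R : realType} {m : nat}.
Implicit Types u v : 'rV[R]_m -> R.

Definition Lpnorm_from (p h : R) (f : R -> \bar R) : \bar R :=
  ((\int[lebesgue_measure]_(a in `[h, 1%R]) (f a `^ p)) `^ p^-1)%E.

Definition dp (p : R) u v : \bar R :=
  Lpnorm_from p 0 (fun a => hausdorff_dist (alpha_cut u a) (alpha_cut v a)).

Definition normal_fuzzy u := exists x, u x = 1.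

Definition FB (p : R) : set ('rV[R]_m -> R) :=
  [set u | [/\ forall x, 0 <= u x <= 1, normal_fuzzy u,
    upper_semicontinuous u &
    (Lpnorm_from p 0 (fun a => hausdorff_dist (alpha_cut u a) [set 0%R]) < +oo)%E]].

End fuzzy.

(* The hypothesis 1 <= p is a parameter of the type because the triangle
   inequality below depends on it. *)
Record FBspace (R : realType) (m : nat) (p : R) (p1 : 1 <= p) := mkFBspace {
  fuzzy_fun :> 'rV[R]_m -> R ;
  fuzzy_funP : FB p fuzzy_fun }.
Arguments FBspace {R} m {p} p1.

HB.instance Definition _ R m p p1 := gen_eqMixin (@FBspace R m p p1).
HB.instance Definition _ R m p p1 := gen_choiceMixin (@FBspace R m p p1).

Section eucl_dist_theory.
Context {R : realType} {m : nat}.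
Implicit Types (x y z : 'rV[R]_m) (A B C : set 'rV[R]_m).

Lemma eucl_dist_ge0 x y : 0 <= eucl_dist x y.
Proof. exact: sqrtr_ge0. Qed.

Lemma eucl_distxx x : eucl_dist x x = 0.
Proof.
by rewrite /eucl_dist big1 ?sqrtr0// => i _; rewrite subrr expr0n.
Qed.

Lemma eucl_distC x y : eucl_dist x y = eucl_dist y x.
Proof. by congr Num.sqrt; apply: eq_bigr => i _; rewrite -sqrrN opprB. Qed.

Lemma sum_sqr_ge0 (f : 'I_m -> R) : 0 <= \sum_i f i ^+ 2.
Proof. by apply: sumr_ge0 => i _; exact: sqr_ge0. Qed.

Lemma sum_cauchy (f g : 'I_m -> R) :
  \sum_i f i * g i <=
    Num.sqrt (\sum_i f i ^+ 2) * Num.sqrt (\sum_i g i ^+ 2).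
Proof.
set a := Num.sqrt _; set b := Num.sqrt _.
have a0 : 0 <= a by exact: sqrtr_ge0.
have b0 : 0 <= b by exact: sqrtr_ge0.
have Ea : \sum_i f i ^+ 2 = a ^+ 2 by rewrite sqr_sqrtr// sum_sqr_ge0.
have Eb : \sum_i g i ^+ 2 = b ^+ 2 by rewrite sqr_sqrtr// sum_sqr_ge0.
have E0 (h k : 'I_m -> R) : \sum_i h i ^+ 2 = 0 -> \sum_i h i * k i = 0.
  move=> h0; apply: big1 => i _.
  have /eqP := h0; rewrite psumr_eq0; last by move=> ? _; exact: sqr_ge0.
  by move=> /allP/(_ i); rewrite mem_index_enum sqrf_eq0 => /(_ isT)/eqP ->;
    rewrite mul0r.
have [a00|aN0] := eqVneq a 0.
  by rewrite E0 ?a00 ?mul0r// Ea a00 expr0n.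
have [b00|bN0] := eqVneq b 0.
  under eq_bigr do rewrite mulrC.
  by rewrite E0 ?b00 ?mulr0// Eb b00 expr0n.
have := sum_sqr_ge0 (fun i => b * f i - a * g i).
have -> : \sum_i (b * f i - a * g i) ^+ 2 =
    b ^+ 2 * \sum_i f i ^+ 2 + a ^+ 2 * \sum_i g i ^+ 2
    - 2 * a * b * \sum_i f i * g i.
  rewrite !mulr_sumr -big_split/= -sumrB; apply: eq_bigr => i _.
  by rewrite sqrrB !exprMn; lra.
rewrite Ea Eb => H.
have ab0 : 0 < a * b by rewrite mulr_gt0// lt0r ?a0 ?b0 andbT.
rewrite -(ler_pM2l ab0); nra.
Qed.

Lemma eucl_dist_triangle y x z : eucl_dist x z <= eucl_dist x y + eucl_dist y z.
Proof.
have s0 : 0 <= eucl_dist x y + eucl_dist y z by rewrite addr_ge0 ?eucl_dist_ge0.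
rewrite -(ger0_norm s0) -sqrtr_sqr; apply: ler_wsqrtr.
have -> : \sum_i (x ord0 i - z ord0 i) ^+ 2 =
  \sum_i (x ord0 i - y ord0 i) ^+ 2 + \sum_i (y ord0 i - z ord0 i) ^+ 2 +
   2 * \sum_i (x ord0 i - y ord0 i) * (y ord0 i - z ord0 i).
  rewrite mulr_sumr -!big_split/=; apply: eq_bigr => i _.
  by rewrite !sqrrB; lra.
have := sum_cauchy (fun i => x ord0 i - y ord0 i) (fun i => y ord0 i - z ord0 i).
rewrite -/(eucl_dist x y) -/(eucl_dist y z).
rewrite -(@sqr_sqrtr _ (\sum_i (x ord0 i - y ord0 i) ^+ 2)) ?sum_sqr_ge0//.
rewrite -(@sqr_sqrtr _ (\sum_i (y ord0 i - z ord0 i) ^+ 2)) ?sum_sqr_ge0//.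
rewrite -/(eucl_dist x y) -/(eucl_dist y z) sqrrD => ?; lra.
Qed.

Lemma coord_le_eucl_dist x y i : `|x ord0 i - y ord0 i| <= eucl_dist x y.
Proof.
rewrite -sqrtr_sqr; apply: ler_wsqrtr.
by rewrite (bigD1 i)//= lerDl; apply: sumr_ge0 => j _; exact: sqr_ge0.
Qed.

Lemma eucl_dist_lt_coord x y (e : R) : 0 < e ->
  (forall i, `|x ord0 i - y ord0 i| < e / m.+1%:R) -> eucl_dist x y < e.
Proof.
move=> e0 H.
have m0 : 0 < m.+1%:R :> R by [].
rewrite -(ger0_norm (ltW e0)) -sqrtr_sqr ltr_sqrt ?exprn_gt0//.
apply: (@le_lt_trans _ _ (\sum_(i < m) (e / m.+1%:R) ^+ 2)).
  apply: ler_sum => i _; rewrite -real_normK ?num_real//.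
  by rewrite ler_pXn2r ?nnegrE ?divr_ge0 ?(ltW e0)// ltW.
rewrite sumr_const card_ord -[X in X < _]mulr_natr expr_div_n -mulrA gtr_pMr ?exprn_gt0//.
rewrite mulrC ltr_pdivrMr ?exprn_gt0// mul1r expr2.
by rewrite (@lt_le_trans _ _ m.+1%:R) ?ltr_nat// ler_peMr// ler1n.
Qed.

Lemma eucl_dist_nbhs x (V : set 'rV[R]_m) : nbhs x V ->
  exists2 e, 0 < e & forall y, eucl_dist x y < e -> V y.
Proof.
move=> /nbhs_ballP[e /= e0 eV]; exists e => // y xy; apply: eV.
split=> // i j; rewrite (ord1 i).
exact: le_lt_trans (coord_le_eucl_dist x y j) xy.
Qed.

Lemma rat_dense x (e : R) : 0 < e ->
  exists q : 'rV[rat]_m, eucl_dist x (map_mx ratr q) < e.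
Proof.
move=> e0.
have em : 0 < e / m.+1%:R by rewrite divr_gt0.
have H i : exists q : rat, `|x ord0 i - ratr q| < e / m.+1%:R.
  move: em; set d := e / _ => d0.
  have /rat_in_itvoo[q] : x ord0 i - d < x ord0 i + d by lra.
  by rewrite in_itv/= => ?; exists q; rewrite ltr_norml; lra.
have [f Hf] := choice H.
exists (\row_i f i); apply: eucl_dist_lt_coord => // i; rewrite !mxE; exact: Hf.
Qed.

Let infd x A : R := inf [set eucl_dist x a | a in A].

Let infd_inf x A : A !=set0 -> has_inf [set eucl_dist x a | a in A].
Proof.
move=> [a Aa]; split; first by exists (eucl_dist x a), a.
by exists 0 => _ [b _ <-]; exact: eucl_dist_ge0.
Qed.

Let infd_le x A a : A a -> infd x A <= eucl_dist x a.
Proof.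
move=> Aa; apply: ge_inf; last by exists a.
by exists 0 => _ [b _ <-]; exact: eucl_dist_ge0.
Qed.

Let infd_lb x A r : A !=set0 ->
  (forall a, A a -> r <= eucl_dist x a) -> r <= infd x A.
Proof.
move=> [a Aa] H; apply: lb_le_inf; first by exists (eucl_dist x a), a.
by move=> _ [b Ab <-]; exact: H.
Qed.

Let infd_lip x y A : A !=set0 -> infd x A <= eucl_dist x y + infd y A.
Proof.
move=> A0; rewrite -lerBlDl; apply: infd_lb => // a Aa.
by rewrite lerBlDl (le_trans (infd_le x Aa))// eucl_dist_triangle.
Qed.

Let infdE x A : A !=set0 ->
  ereal_inf [set (eucl_dist x a)%:E | a in A] = (infd x A)%:E.
Proof.
move=> A0; rewrite /infd -ereal_inf_EFin//.
- by rewrite image_comp.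
- by case: (infd_inf x A0).
- by case: (infd_inf x A0).
Qed.

Definition ratpt (n : nat) : 'rV[R]_m :=
  map_mx ratr (odflt 0 (unpickle n : option 'rV[rat]_m)).

Let gap A B n : R := `|infd (ratpt n) A - infd (ratpt n) B|.

Let hausdorff_gap A B : A !=set0 -> B !=set0 ->
  hausdorff_dist A B = ereal_sup (range (fun n => (gap A B n)%:E)).
Proof.
move=> A0 B0.
have half C D : C !=set0 -> D !=set0 ->
    (ereal_sup [set ereal_inf [set (eucl_dist a b)%:E | b in D] | a in C] <=
    ereal_sup (range (fun n => (gap C D n)%:E)))%E.
  move=> C0 D0; apply: ge_ereal_sup => _ [a Ca <-]; rewrite infdE//.
  apply/lee_addgt0Pr => e e0.
  have e20 : 0 < e / 2 by rewrite divr_gt0.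
  have [q aq] := rat_dense a e20.
  have Eq : ratpt (pickle q) = map_mx ratr q by rewrite /ratpt pickleK.
  apply: (@le_trans _ _ ((gap C D (pickle q))%:E + e%:E)%E); last first.
    by apply: leeD => //; apply: ereal_sup_ubound; exists (pickle q).
  rewrite -EFinD lee_fin /gap Eq.
  have h1 := infd_lip a (map_mx ratr q) D0.
  have h2 := infd_le (map_mx ratr q) Ca.
  rewrite eucl_distC in h2.
  have h3 := ler_norm (infd (map_mx ratr q) D - infd (map_mx ratr q) C).
  rewrite distrC in h3; lra.
have gapC C D : gap C D = gap D C by apply/funext => n; rewrite /gap distrC.
have hE C D : [set ereal_inf [set (eucl_dist a b)%:E | a in C] | b in D] =
    [set ereal_inf [set (eucl_dist b a)%:E | a in C] | b in D].
  apply: eq_imagel => b _; congr ereal_inf.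
  by apply: eq_imagel => a _; rewrite eucl_distC.
apply/eqP; rewrite eq_le; apply/andP; split.
  by rewrite ge_max half//= hE gapC half.
apply: ge_ereal_sup => _ [n _ <-].
have key C D : C !=set0 -> D !=set0 ->
  ((infd (ratpt n) D - infd (ratpt n) C)%:E <=
    ereal_sup [set ereal_inf [set (eucl_dist a b)%:E | b in D] | a in C])%E.
  move=> C0 D0; set s := ereal_sup _.
  have sge a : C a -> ((infd a D)%:E <= s)%E.
    by move=> Ca; rewrite -infdE//; apply: ereal_sup_ubound; exists a.
  case: s sge => [s| |] sge; last 2 first.
  - by rewrite leey.
  - by case: C0 => a /sge; rewrite leeNy_eq.
  rewrite lee_fin; have : infd (ratpt n) D - s <= infd (ratpt n) C.
    apply: infd_lb => // a /[dup] Ca /sge; rewrite lee_fin => h.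
    have := infd_lip (ratpt n) a D0; lra.
  by lra.
rewrite /gap /hausdorff_dist; have [h|h] := leP 0 (infd (ratpt n) A - infd (ratpt n) B).
  rewrite (ger0_norm h) le_max; apply/orP; right; rewrite hE; exact: key.
rewrite (ltr0_norm h) opprB le_max; apply/orP; left; exact: key.
Qed.

Lemma hausdorffC A B : hausdorff_dist A B = hausdorff_dist B A.
Proof.
rewrite /hausdorff_dist maxC; congr Order.max; congr ereal_sup;
  apply: eq_imagel => x _; congr ereal_inf; apply: eq_imagel => y _;
  by rewrite eucl_distC.
Qed.

Lemma hausdorff_ge0 A B : A !=set0 -> B !=set0 -> (0 <= hausdorff_dist A B)%E.
Proof.
move=> A0 B0; rewrite hausdorff_gap//.
apply: (@le_trans _ _ (gap A B 0)%:E); first by rewrite lee_fin normr_ge0.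
by apply: ereal_sup_ubound; exists 0%N.
Qed.

Lemma hausdorffxx A : A !=set0 -> hausdorff_dist A A = 0%E.
Proof.
move=> A0; apply/eqP; rewrite eq_le hausdorff_ge0// andbT hausdorff_gap//.
by apply: ge_ereal_sup => _ [n _ <-]; rewrite /gap subrr normr0.
Qed.

Lemma hausdorff_triangle B A C : A !=set0 -> B !=set0 -> C !=set0 ->
  (hausdorff_dist A C <= hausdorff_dist A B + hausdorff_dist B C)%E.
Proof.
move=> A0 B0 C0; rewrite !hausdorff_gap//.
apply: ge_ereal_sup => _ [n _ <-].
apply: (@le_trans _ _ ((gap A B n)%:E + (gap B C n)%:E)%E).
  by rewrite -EFinD lee_fin /gap ler_distD.
by apply: leeD; apply: ereal_sup_ubound; exists n.
Qed.

Lemma hausdorff0_sub A B : closed B -> B !=set0 -> hausdorff_dist A B = 0%E ->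
  A `<=` B.
Proof.
move=> cB B0 H a Aa; apply: cB => V /eucl_dist_nbhs[e e0 eV].
have : (ereal_inf [set (eucl_dist a b)%:E | b in B] <= 0)%E.
  rewrite -H /hausdorff_dist le_max; apply/orP; left.
  by apply: ereal_sup_ubound; exists a.
rewrite infdE// lee_fin => h.
have [_ [b Bb <-] hb] := inf_adherent e0 (infd_inf a B0).
exists b; split=> //; apply: eV; move: hb; rewrite -/(infd a B) => hb; lra.
Qed.

Lemma measurable_hausdorff (F G : R -> set 'rV[R]_m) :
  (forall a, 0 <= a <= 1 -> F a !=set0) ->
  (forall a, 0 <= a <= 1 -> G a !=set0) ->
  (forall a b, 0 <= a <= b -> b <= 1 -> F b `<=` F a) ->
  (forall a b, 0 <= a <= b -> b <= 1 -> G b `<=` G a) ->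
  measurable_fun (`[0, 1] : set R)
    ((fun a => hausdorff_dist (F a) (G a)) : R -> \bar R).
Proof.
move=> F0 G0 FS GS.
pose c (a : R) := Num.max 0 (Num.min a 1).
have c01 a : 0 <= c a <= 1.
  by rewrite /c le_max lexx/= ge_max ler01 ge_min lexx orbT.
have cE a : (`[0, 1]%classic : set R) a -> c a = a.
  by rewrite /= in_itv/= => /andP[a0 a1]; rewrite /c min_l// max_r.
have chomo a b : a <= b -> c a <= c b.
  move=> ab; rewrite /c ge_max le_max lexx/= le_max.
  by apply/orP; right; rewrite le_min !ge_min ab lexx orbT.
have minfd (K : R -> set 'rV[R]_m) n :
    (forall a, 0 <= a <= 1 -> K a !=set0) ->
    (forall a b, 0 <= a <= b -> b <= 1 -> K b `<=` K a) ->
    measurable_fun (`[0, 1] : set R) (fun a => infd (ratpt n) (K (c a))).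
  move=> K0 KS; apply: nondecreasing_measurable => // a b ab.
  apply: infd_lb; first exact: K0.
  move=> x Kx; apply: infd_le; apply: KS Kx.
    by rewrite chomo// andbT; case/andP: (c01 a).
  by case/andP: (c01 b).
pose g n a := (`|infd (ratpt n) (F (c a)) - infd (ratpt n) (G (c a))|)%:E.
apply: (@eq_measurable_fun _ _ _ _ _ (fun a => ereal_sup (range (g ^~ a)))).
  move=> a; rewrite inE => a01; rewrite hausdorff_gap//.
  - by rewrite /g cE.
  - by apply: F0; move: a01; rewrite /= in_itv.
  - by apply: G0; move: a01; rewrite /= in_itv.
have -> : (fun a => ereal_sup (range (g ^~ a))) = (fun a => esups (g ^~ a) 0).
  by apply/funext => a; rewrite /esups; congr ereal_sup; apply/seteqP;
    split=> [_ [n _ <-]|_ [n _ <-]]; exists n.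
apply: measurable_fun_esups => n.
apply/measurable_EFinP; apply: measurableT_comp => //.
by apply: measurable_funB; exact: minfd.
Qed.

End eucl_dist_theory.

Section Lp_triangle.
Context d (T : measurableType d) (R : realType).
Variables (mu : {measure set T -> \bar R}) (D : set T) (p : R).
Hypotheses (mD : measurable D) (p1 : 1 <= p).
Implicit Types f g h : T -> \bar R.
Local Open Scope ereal_scope.

Let N f := (\int[mu]_(x in D) (f x `^ p)) `^ p^-1.

Let p_gt0 : (0 < p)%R. Proof. exact: lt_le_trans p1. Qed.

Let mpow f : measurable_fun D f -> measurable_fun D (fun x => f x `^ p).
Proof. by move=> mf; apply: (measurableT_comp (measurable_poweR p)). Qed.

Let N_Lnorm f (r : T -> R) : measurable_fun D f -> measurable_fun D r ->
  (forall x, D x -> 0 <= r x)%R -> ae_eq mu D f (EFin \o r) ->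
  N f = 'N[mu]_p%:E[EFin \o (r \_ D)].
Proof.
move=> mf mr r0 fr; rewrite unlock /N; congr poweR.
transitivity (\int[mu]_(x in D) ((r x)%:E `^ p)).
  apply: ge0_ae_eq_integral => //.
  - exact: mpow.
  - by apply: mpow; exact/measurable_EFinP.
  - by move=> x _; exact: poweR_ge0.
  - by move=> x _; exact: poweR_ge0.
  - by apply: filterS fr => x /[apply] ->.
rewrite integral_mkcond; apply: eq_integral => x _.
rewrite /= !patchE; case: ifPn => xD.
  by rewrite ger0_norm// r0//; exact/set_mem.
by rewrite normr0 powR0// gt_eqF.
Qed.

Let N_fin f : measurable_fun D f -> (forall x, D x -> 0 <= f x) ->
  N f < +oo -> {ae mu, forall x, D x -> f x \is a fin_num}.
Proof.
move=> mf f0 Nf.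
have : mu.-integrable D (fun x => f x `^ p).
  apply/integrableP; split; first exact: mpow.
  under eq_integral do rewrite gee0_abs ?poweR_ge0//.
  apply: lty_poweRy Nf; by rewrite invr_eq0 gt_eqF.
move=> /(integrable_ae mD); apply: filterS => x /[swap] Dx /(_ Dx) fx.
rewrite ge0_fin_numE ?f0//; apply: (@lty_poweRy _ _ p); first by rewrite gt_eqF.
by rewrite ltey_eq fx.
Qed.

Lemma Lp_triangle f g h :
  measurable_fun D f -> measurable_fun D g -> measurable_fun D h ->
  (forall x, D x -> 0 <= f x) -> (forall x, D x -> 0 <= g x) ->
  (forall x, D x -> 0 <= h x <= f x + g x) ->
  (\int[mu]_(x in D) (h x `^ p)) `^ p^-1 <=
  (\int[mu]_(x in D) (f x `^ p)) `^ p^-1 +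
  (\int[mu]_(x in D) (g x `^ p)) `^ p^-1.
Proof.
move=> mf mg mh f0 g0 hfg; rewrite -/(N f) -/(N g).
have [Nf|] := boolP (N f < +oo); last first.
  rewrite -leNgt leye_eq => /eqP ->; rewrite addye ?leey// -ltNye.
  by rewrite (lt_le_trans _ (poweR_ge0 _ _)).
have [Ng|] := boolP (N g < +oo); last first.
  rewrite -leNgt leye_eq => /eqP ->; rewrite addey ?leey// -ltNye.
  by rewrite (lt_le_trans _ (poweR_ge0 _ _)).
have ff := N_fin mf f0 Nf; have gg := N_fin mg g0 Ng.
pose F := fine \o f; pose G := fine \o g.
have mF : measurable_fun D F by exact: measurableT_comp.
have mG : measurable_fun D G by exact: measurableT_comp.
have F0 x : D x -> (0 <= F x)%R by move=> /f0; exact: fine_ge0.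
have G0 x : D x -> (0 <= G x)%R by move=> /g0; exact: fine_ge0.
apply: (@le_trans _ _ (N (f \+ g))).
  rewrite /N; apply: gt0_ler_poweR.
  - by rewrite invr_ge0 ltW.
  - by rewrite in_itv/= leey andbT integral_ge0// => x _; exact: poweR_ge0.
  - by rewrite in_itv/= leey andbT integral_ge0// => x _; exact: poweR_ge0.
  apply: ge0_le_integral => //.
  - by move=> x _; exact: poweR_ge0.
  - exact: mpow.
  - by apply: mpow; exact: emeasurable_funD.
  move=> x Dx; have /andP[h0 hh] := hfg _ Dx.
  apply: gt0_ler_poweR => //; first exact: ltW.
  - by rewrite in_itv/= leey andbT.
  - by rewrite in_itv/= leey andbT adde_ge0// ?f0 ?g0.
rewrite (@N_Lnorm (f \+ g) (F \+ G)%R)//; first last.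
- by apply: filterS2 ff gg => x fx gx Dx; rewrite /= EFinD !fineK ?fx ?gx.
- by move=> x Dx; rewrite addr_ge0 ?F0 ?G0.
- exact: measurable_funD.
- exact: emeasurable_funD.
rewrite (N_Lnorm mf mF F0); last first.
  by apply: filterS ff => x /[apply] fx; rewrite /= fineK.
rewrite (N_Lnorm mg mG G0); last first.
  by apply: filterS gg => x /[apply] gx; rewrite /= fineK.
have -> : ((F \+ G) \_ D = (F \_ D) \+ (G \_ D))%R.
  by apply/funext => x; rewrite /= !patchE; case: ifPn => //; rewrite addr0.
by apply: minkowski_EFin => //; exact/(measurable_restrictT _ mD).
Qed.

Lemma Lp_eq0 f : measurable_fun D f -> (forall x, D x -> 0 <= f x) ->
  (\int[mu]_(x in D) (f x `^ p)) `^ p^-1 = 0 ->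
  {ae mu, forall x, D x -> f x = 0}.
Proof.
move=> mf f0 /poweR_eq0_eq0 H.
have /ae_eq_integral_abs : \int[mu]_(x in D) `|f x `^ p| = 0.
  under eq_integral do rewrite gee0_abs ?poweR_ge0//.
  by apply: H; apply: integral_ge0 => x _; exact: poweR_ge0.
move=> /(_ mD (mpow mf)); apply: filterS => x /[swap] Dx /(_ Dx)/=.
by apply: poweR_eq0_eq0; exact: f0.
Qed.

End Lp_triangle.

Section FB_metric.
Context {R : realType} {m : nat} {p : R} {p1 : 1 <= p}.
Implicit Types u v w : @FBspace R m p p1.

Lemma cut_neq0 u a : 0 <= a <= 1 -> alpha_cut u a !=set0.
Proof.
case: u => u [/= _ [x ux] _ _] /andP[a0 a1]; exists x.
rewrite /alpha_cut; case: ifPn => _; last by rewrite /= ux.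
by apply: subset_closure; rewrite /= ux.
Qed.

Lemma cut_homo u a b : 0 <= a <= b -> alpha_cut u b `<=` alpha_cut u a.
Proof.
rewrite /alpha_cut => /andP[a0 ab].
have [b0|b0] := eqVneq b 0.
  by have -> : a = 0 by [apply/eqP; rewrite eq_le a0 -b0 ab]; rewrite eqxx.
case: ifPn => _ x /= bx; last exact: le_trans bx.
apply: subset_closure => /=; apply: lt_le_trans bx.
by rewrite lt_neqAle eq_sym b0 (le_trans a0).
Qed.

Lemma cut_closed u a : closed (alpha_cut u a).
Proof.
rewrite /alpha_cut; case: ifPn => _; first exact: closed_closure.
case: u => u [/= _ _ usc _].
rewrite -openC openE => x /= /negP; rewrite -ltNge => /usc; rewrite /interior.
by apply: filterS => y /=; rewrite ltNge => /negP.
Qed.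

Let m01 : measurable (`[0, 1]%classic : set R).
Proof. exact: measurable_itv. Qed.

Let in01 (a : R) : (`[0, 1]%classic : set R) a -> 0 <= a <= 1.
Proof. by rewrite /= in_itv. Qed.

Let mH u v : measurable_fun (`[0, 1] : set R)
  ((fun a => hausdorff_dist (alpha_cut u a) (alpha_cut v a)) : R -> \bar R).
Proof.
apply: measurable_hausdorff => *;
  by [exact: cut_neq0 | exact: cut_homo].
Qed.

Let mH0 u : measurable_fun (`[0, 1] : set R)
  ((fun a => hausdorff_dist (alpha_cut u a) [set 0]) : R -> \bar R).
Proof.
apply: (@measurable_hausdorff _ _ _ (fun=> [set 0])) => [a|a _|a b|a b _ _].
- exact: cut_neq0.
- by exists 0.
- by move=> ab _; exact: cut_homo.
- exact: subset_refl.
Qed.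

Lemma dp_ge0 u v : (0 <= dp p u v)%E.
Proof. exact: poweR_ge0. Qed.

Lemma dp_fin_num u v : dp p u v \is a fin_num.
Proof.
rewrite ge0_fin_numE ?dp_ge0//.
have [_ _ _ ul] := fuzzy_funP u; have [_ _ _ vl] := fuzzy_funP v.
apply: le_lt_trans (lte_add_pinfty ul vl).
have n0 : [set (0 : 'rV[R]_m)] !=set0 by exists 0.
apply: (Lp_triangle lebesgue_measure m01 p1 (mH0 u) (mH0 v) (mH u v)) =>
  a /in01 a01.
- by apply: hausdorff_ge0 => //; exact: cut_neq0.
- by apply: hausdorff_ge0 => //; exact: cut_neq0.
- apply/andP; split; first by apply: hausdorff_ge0; exact: cut_neq0.
  rewrite [X in (_ <= _ + X)%E]hausdorffC.
  by apply: hausdorff_triangle => //; exact: cut_neq0.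
Qed.

Definition FB_dist u v : R := fine (dp p u v).

Lemma FB_distE u v : (FB_dist u v)%:E = dp p u v.
Proof. by rewrite fineK// dp_fin_num. Qed.

Let FB_distxx u : FB_dist u u = 0.
Proof.
apply: EFin_inj; rewrite FB_distE /dp /Lpnorm_from.
have p0 : p != 0 by rewrite gt_eqF// (lt_le_trans _ p1).
rewrite integral0_eq ?poweR0r ?invr_eq0// => a /in01 a01.
by rewrite hausdorffxx ?poweR0r//; exact: cut_neq0.
Qed.

Let FB_distC u v : FB_dist u v = FB_dist v u.
Proof.
rewrite /FB_dist /dp; congr (fine (Lpnorm_from _ _ _)).
by apply/funext => a; rewrite hausdorffC.
Qed.

Let FB_dist_triangle v u w : FB_dist u w <= FB_dist u v + FB_dist v w.
Proof.
rewrite -lee_fin EFinD !FB_distE.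
apply: (Lp_triangle lebesgue_measure m01 p1 (mH u v) (mH v w) (mH u w)) =>
  a /in01 a01;
  rewrite ?hausdorff_ge0 ?hausdorff_triangle//=; exact: cut_neq0.
Qed.

Let cuts_le u v x : FB_dist u v = 0 -> v x <= u x.
Proof.
move=> uv; rewrite leNgt; apply/negP => uvx.
have : dp p u v = 0%E by rewrite -FB_distE uv.
move=> /(Lp_eq0 (mu := lebesgue_measure) m01 (mH u v)) H.
have {H} [|Z [mZ Z0 subZ]] := H _.
  by move=> a /in01 a01; apply: hausdorff_ge0; exact: cut_neq0.
have [u01 _ _ _] := fuzzy_funP u; have [v01 _ _ _] := fuzzy_funP v.
have /andP[ux0 _] := u01 x; have /andP[_ vx1] := v01 x.
have : (lebesgue_measure (`]u x, v x[ : set R) <= lebesgue_measure Z)%E.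
  apply: le_measure; rewrite ?inE//.
  move=> a /=; rewrite in_itv/= => /andP[ua av]; apply: subZ => /= H.
  have a0 : 0 < a by exact: le_lt_trans ua.
  have a01 : 0 <= a <= 1 by rewrite ltW//= (le_trans (ltW av)).
  have h0 : hausdorff_dist (alpha_cut v a) (alpha_cut u a) = 0%E.
    by rewrite hausdorffC; apply: H; rewrite in_itv.
  have /(_ x) := hausdorff0_sub (cut_closed (a := a)) (cut_neq0 u a01) h0.
  rewrite /alpha_cut gt_eqF//= => /(_ (ltW av)); by rewrite leNgt ua.
rewrite Z0 lebesgue_measure_itv/= lte_fin uvx -EFinB lee_fin.
by rewrite leNgt subr_gt0 uvx.
Qed.

Let FB_dist_eq0 u v : FB_dist u v = 0 -> u = v.
Proof.
move=> uv; have : (u : _ -> R) = v.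
  apply/funext => x; apply/eqP.
  by rewrite eq_le !cuts_le//= FB_distC.
case: u v {uv} => u Pu [v Pv]/= uv.
by rewrite uv in Pu *; congr mkFBspace; exact: Prop_irrelevance.
Qed.

HB.instance Definition _ := @isMetric.Build R (@FBspace R m p p1)
  FB_dist FB_distxx FB_dist_eq0 FB_distC FB_dist_triangle.

End FB_metric.

Definition totally_bounded {R : realType} {T : pseudoMetricType R}
    (U : set T) :=
  forall e : R, 0 < e ->
    exists2 F : set T, finite_set F & U `<=` \bigcup_(x in F) ball x e.

Section subsets.
Context {R : realType} {m : nat} {p : R} {p1 : 1 <= p}.
Implicit Types U : set (@FBspace R m p p1).

Definition fuzzy_convex : set (@FBspace R m p p1) :=
  [set u | forall (x y : 'rV[R]_m) (l : R), 0 <= l <= 1 ->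
    Num.min (u x) (u y) <= u (l *: x + (1 - l) *: y)].

Definition star_shaped0 : set (@FBspace R m p p1) :=
  [set u | forall (y : 'rV[R]_m) (l : R), 0 <= l <= 1 -> u y <= u (l *: y)].

Definition star_shaped : set (@FBspace R m p p1) :=
  [set u | exists x : 'rV[R]_m, forall (y : 'rV[R]_m) (l : R), 0 <= l <= 1 ->
    u y <= u (l *: y + (1 - l) *: x)].

Definition cut_star_shaped : set (@FBspace R m p p1) :=
  [set u | forall a : R, 0 < a <= 1 ->
    exists2 x : 'rV[R]_m, alpha_cut u a x &
      forall y : 'rV[R]_m, alpha_cut u a y ->
        forall l : R, 0 <= l <= 1 -> alpha_cut u a (l *: y + (1 - l) *: x)].

Definition mean_bounded U :=
  exists2 M : R, 0 < M &
    forall u, U u -> (dp p u \1_[set 0%R] <= M%:E)%E.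

Definition mean_equi_left_continuous U :=
  forall e : R, 0 < e -> exists2 delta : R, 0 < delta &
    forall h : R, 0 <= h < delta -> forall u, U u ->
      (Lpnorm_from p h (fun a => hausdorff_dist (alpha_cut u a) (alpha_cut u (a - h)))
        < e%:E)%E.

End subsets.

(* Main.v *)
(** Write f_u(a) = H([u]_a, {0}), a nonincreasing function of a; a bound M on its
    L^p norm bounds [u]_a by M / a^(1/p). Since the cuts are nested,
    H([u]_a, [u]_c) <= H([u]_a, [u]_(a-h)) whenever a - h <= c <= a.

    If U satisfies (i) and (ii), shifting [0, h] by s >> h shows that the norm of
    f_u over [0, h] is uniformly small, while over [h, 1] the function u is
    determined up to a small error by its cuts at the finitely many levels k h,
    which lie in a fixed ball; a finite net of that ball yields a finite net
    of U. Conversely, (i) and (ii) hold for a single u and pass to uniform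
    limits, hence to totally bounded sets.

    Relative compactness follows from completeness. If (u_n) is rapidly Cauchy,
    then for almost every a the cuts [u_n]_a are Cauchy for the Hausdorff metric.
    Let K_a be their Kuratowski lower limit and let [u]_a be the intersection of
    the K_b, b < a. Then [u]_a = K_a outside a countable set of levels, so Fatou's
    lemma gives u_n -> u, and each of the four star or convexity conditions is
    inherited, cluster points of centres serving as centres. *)

Require Import Defs.
From HB Require Import structures.
From mathcomp Require Import all_boot all_order all_algebra.
From mathcomp Require Import all_classical all_reals all_analysis.
From mathcomp Require Import measurable_realfun lra.

Set Implicit Arguments.
Unset Strict Implicit.
Unset Printing Implicit Defensive.

Import Order.TTheory GRing.Theory Num.Theory.
Import numFieldNormedType.Exports.

Local Open Scope classical_set_scope.
Local Open Scope ring_scope.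

(** * Total boundedness and compact closures in pseudometric spaces *)

Section compactness.
Context {R : realType}.

Lemma compact_totally_bounded (T : pseudoMetricType R) (K : set T) :
  compact K -> totally_bounded K.
Proof.
move=> /compact_near_coveringP cK e e0.
(* [F] collects the properties shared by all sets of centres that contain some finite set. The
   near-covering form of compactness then gives one finite set of centres that serves all of [K]. *)
pose F : set_system (set T) := [set P | exists2 S, finite_set S &
  forall S', S `<=` S' -> P S'].
have FF : Filter F.
  split=> [|P Q [S fS SP] [S' fS' SQ]|P Q PQ [S fS SP]].
  - by exists set0.
  - exists (S `|` S'); first by rewrite finite_setU.
    by move=> V SV; split; [apply: SP|apply: SQ];
      apply: subset_trans SV => x; [left|right].
  - by exists S => // S' /SP/PQ.
have [|S fS SP] := cK _ F (fun S x => exists2 c, S c & ball c e x) FF.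
  move=> x Kx; exists (ball x e, [set S | S x]) => /=.
    split; first exact: nbhsx_ballx.
    by exists [set x] => //= S'; apply.
  by case=> y S /= [xy Sx]; exists x.
by exists S => // x Kx; have [c Sc cx] := SP _ (@subset_refl _ S) _ Kx; exists c.
Qed.

(** An ultrafilter contains each set or its complement, so members of the finite family that do not
    belong to it can be discarded one by one; not all can be, since the empty set is excluded. *)
Lemma ultra_finite_cover (T : Type) (I : choiceType) (F : set_system T)
    (S : set I) (f : I -> set T) :
  UltraFilter F -> finite_set S -> F (\bigcup_(i in S) f i) ->
  exists2 i, S i & F (f i).
Proof.
move=> FU /finite_seqP[s ->]; elim: s => [|i s IH] FS.
  by move: FS; rewrite set_nil bigcup_set0 => /filter_not_empty.
have [Fi|nFi] := in_ultra_setVsetC (f i) FU; first by exists i; rewrite //= mem_head.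
have [|j js Fj] := IH; last by exists j => //=; rewrite inE; apply/orP; right.
apply: filterS (filterI FS nFi) => x [[j /=]].
by rewrite inE => /orP[/eqP ->//|js fj _]; exists j.
Qed.

(** Completeness is asked only along sequences with steps below q^n, the form in which limits are
    constructed later. An ultrafilter that contains [closure U] contains a ball of every radius, and
    suitable centres form such a sequence. *)
Lemma totally_bounded_compact_closure (T : pseudoMetricType R) (U : set T)
    (q : R) : 0 < q < 1 ->
  (forall s : nat -> T, (forall n, ball (s n) (q ^+ n) (s n.+1)) ->
    exists l, forall e, 0 < e -> exists N, forall n, (N <= n)%N -> ball l e (s n)) ->
  totally_bounded U -> compact (closure U).
Proof.
move=> /andP[q0 q1] cT tU; rewrite compact_ultra => F FU FcU.
have qn0 n : 0 < q ^+ n by rewrite exprn_gt0.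
(* Points of the closure lie within e / 2 of [U], so doubling the radii of an e / 2 net of [U]
   covers the closure, and the ultrafilter selects one of the balls. *)
have H (e : R) : 0 < e -> exists x, F (ball x e).
  move=> e0; have [S fS US] := tU _ (divr_gt0 e0 (@ltr0n R 2)).
  have [|x _ Fx] := @ultra_finite_cover _ _ F S (fun x => ball x e) FU fS; last by exists x.
  apply: filterS FcU => x /(_ _ (nbhsx_ballx x _ (divr_gt0 e0 (@ltr0n R 2)))).
  move=> [y [/US[c Sc cy] xy]]; exists c => //.
  by rewrite (splitr e); apply: ball_triangle cy _; exact: ball_sym.
have /choice[s sP] n : exists x, F (ball x (q ^+ n / 2)).
  by apply: H; rewrite divr_gt0.
(* Consecutive balls both belong to the ultrafilter, hence meet; the halved radii keep their centres
   less than q^n apart. *)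
have [n|l sl] := cT s.
  have [x [x1 x2]] := filter_ex (filterI (sP n) (sP n.+1)).
  rewrite (splitr (q ^+ n)); apply: ball_triangle x1 _.
  apply: ball_sym; apply: le_ball x2; rewrite ler_pM2r// exprS.
  by rewrite ger_pMl// ltW.
have Fl : F --> l.
  apply/cvg_ballP => e e0; have e20 := divr_gt0 e0 (@ltr0n R 2).
  have [N Nl] := sl _ e20.
  have [M _ Mq] : \forall n \near \oo, `|0 - q ^+ n| < e.
    have /cvgrPdist_lt : (GRing.exp q : R ^nat) @ \oo --> (0 : R).
      by apply: cvg_expr; rewrite ger0_norm// ltW.
    exact.
  have := sP (maxn M N); apply: filterS => x sx.
  rewrite (splitr e); apply: ball_triangle (Nl _ (leq_maxr _ _)) _.
  apply: le_ball sx; rewrite ler_pM2r//.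
  have := Mq _ (leq_maxl M N); rewrite sub0r normrN ger0_norm ?(ltW (qn0 _))//.
  exact: ltW.
exists l; split=> //; apply: (closed_cvg (closure U)) Fl; last exact: FcU.
exact: closed_closure.
Qed.

End compactness.

(** * Hausdorff distance, bounded sequences and finite nets in Euclidean space *)

Section hausdorff.
Context {R : realType} {m : nat}.
Implicit Types (x y z : 'rV[R]_m) (A B C : set 'rV[R]_m).

(** Reduces bounds between Hausdorff distances, which may be infinite, to bounds by real numbers. *)
Lemma lee_lt_EFin (x y : \bar R) : (0 <= x)%E ->
  (forall r : R, (x < r%:E)%E -> (y <= r%:E)%E) -> (y <= x)%E.
Proof.
case: x => [x| |] // _ H; last by rewrite leey.
apply/lee_addgt0Pr => e e0; rewrite -EFinD; apply: H.
by rewrite lte_fin ltrDl.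
Qed.

Lemma hausdorff_le A B (r : R) :
  (forall a, A a -> exists2 b, B b & eucl_dist a b <= r) ->
  (forall b, B b -> exists2 a, A a & eucl_dist a b <= r) ->
  (hausdorff_dist A B <= r%:E)%E.
Proof.
move=> AB BA; rewrite /hausdorff_dist ge_max; apply/andP; split.
  apply: ge_ereal_sup => _ [a /AB[b Bb ab] <-].
  by apply: (@le_trans _ _ (eucl_dist a b)%:E);
    [apply: ereal_inf_lbound; exists b|rewrite lee_fin].
apply: ge_ereal_sup => _ [b /BA[a Aa ab] <-].
by apply: (@le_trans _ _ (eucl_dist a b)%:E);
  [apply: ereal_inf_lbound; exists a|rewrite lee_fin].
Qed.

Lemma hausdorff_lt_l A B (r : R) a : (hausdorff_dist A B < r%:E)%E -> A a ->
  exists2 b, B b & eucl_dist a b < r.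
Proof.
rewrite /hausdorff_dist gt_max => /andP[+ _] Aa => H.
have : (ereal_inf [set (eucl_dist a b)%:E | b in B] < r%:E)%E.
  by apply: le_lt_trans H; apply: ereal_sup_ubound; exists a.
by move=> /ereal_inf_lt[_ [b Bb <-]]; rewrite lte_fin; exists b.
Qed.

Lemma hausdorff_lt_r A B (r : R) b : (hausdorff_dist A B < r%:E)%E -> B b ->
  exists2 a, A a & eucl_dist a b < r.
Proof.
rewrite hausdorffC => H /(hausdorff_lt_l H)[a Aa]; rewrite eucl_distC.
by exists a.
Qed.

(** A point of [C] lies in [D], hence near a point of [A], which lies in [B]; in the other direction
    [B] is contained in [C]. This makes gaps between nested cuts monotone. *)
Lemma hausdorff_nested A B C D : A !=set0 -> A `<=` B -> B `<=` C -> C `<=` D ->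
  (hausdorff_dist B C <= hausdorff_dist A D)%E.
Proof.
move=> A0 AB BC CD.
have D0 : D !=set0 by case: A0 => a Aa; exists a; exact/CD/BC/AB.
apply: lee_lt_EFin; first exact: hausdorff_ge0.
move=> r ADr; have r0 : 0 <= r.
  by rewrite -lee_fin; apply: le_trans (ltW ADr); exact: hausdorff_ge0.
apply: hausdorff_le => [b Bb|c Cc].
  by exists b; [exact: BC|rewrite eucl_distxx].
have [a Aa ac] := hausdorff_lt_r ADr (CD _ Cc).
by exists a; [exact: AB|exact: ltW].
Qed.

Lemma hausdorff0_le A (r : R) : A !=set0 -> (forall a, A a -> eucl_dist a 0 <= r) ->
  (hausdorff_dist A [set 0%R] <= r%:E)%E.
Proof.
move=> [a Aa] H; apply: hausdorff_le => [b Ab|_ ->]; last by exists a => //; exact: H.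
by exists 0 => //; exact: H.
Qed.

Lemma hausdorff0_ub A (r : R) a : (hausdorff_dist A [set 0%R] <= r%:E)%E -> A a ->
  eucl_dist a 0 <= r.
Proof.
move=> H Aa; apply/ler_addgt0Pr => e e0.
have [|_ -> /ltW//] := @hausdorff_lt_l A [set 0%R] (r + e) a _ Aa.
by apply: le_lt_trans H _; rewrite lte_fin ltrDl.
Qed.

Lemma hausdorff0_mono A B : A !=set0 -> A `<=` B ->
  (hausdorff_dist A [set 0%R] <= hausdorff_dist B [set 0%R])%E.
Proof.
move=> A0 AB; have B0 : B !=set0 by case: A0 => a /AB; exists a.
apply: lee_lt_EFin; first by apply: hausdorff_ge0 => //; exists 0.
move=> r /ltW Br; apply: hausdorff0_le => // a /AB; exact: hausdorff0_ub.
Qed.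

Lemma eucl_ball_nbhs z (e : R) : 0 < e -> nbhs z [set x | eucl_dist x z < e].
Proof.
move=> e0; have em : 0 < e / m.+1%:R by rewrite divr_gt0.
apply/nbhs_ballP; exists (e / m.+1%:R) => //= x [_ xz].
by apply: eucl_dist_lt_coord => // i; rewrite distrC; exact: xz.
Qed.

(** The norm is the sup norm; its closed ball contains the Euclidean ball of the same radius, which
    suffices for cluster points and nets. *)
Lemma eucl_ball_compact (r : R) : compact [set x : 'rV[R]_m | `|x| <= r].
Proof.
apply: bounded_closed_compact.
  exists r; split; first exact: num_real.
  by move=> M rM x /= /le_trans; apply; exact: ltW.
have -> : [set x : 'rV[R]_m | `|x| <= r] = Num.norm @^-1` [set y : R | y <= r] by [].
apply: preimage_closed => [x _|]; [exact: norm_continuous|exact: closed_le].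
Qed.

Lemma mx_norm_le_eucl x (r : R) : eucl_dist x 0 <= r -> `|x| <= r.
Proof.
move=> xr; have r0 : 0 <= r by apply: le_trans xr; exact: eucl_dist_ge0.
rewrite /Num.norm/= mx_normrE; apply/bigmax_leP; split=> //= -[i j] _ /=.
by apply: le_trans xr; have := coord_le_eucl_dist x 0 j; rewrite mxE subr0 (ord1 i).
Qed.

(** Bolzano-Weierstrass, phrased by arbitrarily late indices so that no subsequence has to be
    extracted. *)
Lemma bounded_cluster (x : nat -> 'rV[R]_m) (r : R) :
  (forall n, eucl_dist (x n) 0 <= r) ->
  exists z, forall e, 0 < e -> forall N, exists2 n, (N <= n)%N & eucl_dist (x n) z < e.
Proof.
move=> xr; have [|z [_ zx]] := @eucl_ball_compact r (x @ \oo) _.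
  by exists 0%N => // n _ /=; exact: mx_norm_le_eucl.
exists z => e e0 N.
have [|y [[n Nn <-] /= ny]] := zx (x @` [set n | (N <= n)%N]) _ _ (eucl_ball_nbhs z e0).
  by exists N => // n /= Nn; exists n.
by exists n.
Qed.

Lemma bounded_net (r e : R) : 0 < e ->
  exists s : seq 'rV[R]_m, forall x, eucl_dist x 0 <= r ->
    exists2 g, g \in s & eucl_dist x g < e.
Proof.
move=> e0; have em : 0 < e / m.+1%:R by rewrite divr_gt0.
have [S /finite_seqP[s ->] Ss] :=
  compact_totally_bounded (@eucl_ball_compact r) em.
exists s => x /mx_norm_le_eucl/Ss[g gs [_ gx]]; exists g => //.
by apply: eucl_dist_lt_coord => // i; rewrite distrC; exact: gx.
Qed.

End hausdorff.

(** * L^p norms over intervals: Minkowski, translation, Fatou and dominated convergence *)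

Section Lpnorm_itv.
Context {R : realType}.
Local Open Scope ereal_scope.
Local Notation mu := lebesgue_measure.

Definition shift_fun (h : R) (x : measurableTypeR R) : measurableTypeR R :=
  (x - h)%R.

Lemma measurable_shift_fun h : measurable_fun [set: measurableTypeR R] (shift_fun h).
Proof.
apply: (@measurable_funB _ (measurableTypeR R) R setT id (cst h)).
  exact: measurable_id.
exact: measurable_cst.
Qed.

HB.instance Definition _ h := isMeasurableFun.Build _ _ _ _ (shift_fun h)
  (measurable_shift_fun h).

(** Translation invariance, from the uniqueness of a measure that agrees with the length on
    half-open intervals. *)
Lemma lebesgue_measure_shift (h : R) (A : set R) : measurable A ->
  pushforward mu (shift_fun h) A = mu A.
Proof.
move=> mA; apply/esym/lebesgue_measure_unique => //= _ [[a b]] _ <-.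
rewrite /pushforward.
have -> : shift_fun h @^-1` [set` `]a, b]%R] = [set` `]a + h, b + h]%R].
  by apply/seteqP; split => x /=; rewrite !in_itv/= ltrBrDr lerBlDr.
rewrite !lebesgue_measure_itv/= !lte_fin ltrD2r -!EFinB.
by rewrite opprD addrACA subrr addr0.
Qed.

(** For right endpoint 1 this unfolds to [Lpnorm_from], so [dp] is the case of [0, 1]; a free right
    endpoint allows the unit interval to be cut in two. *)
Definition Lpnorm_itv (p a b : R) (f : R -> \bar R) : \bar R :=
  (\int[mu]_(x in `[a, b]) (f x `^ p)) `^ p^-1.

Variable p : R.
Implicit Types a b c d : R.
Hypothesis p1 : (1 <= p)%R.
Local Notation N := (Lpnorm_itv p).

Let p_gt0 : (0 < p)%R. Proof. exact: lt_le_trans p1. Qed.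
Let p_neq0 : p != 0%R. Proof. by rewrite gt_eqF. Qed.
Let ip_ge0 : (0 <= p^-1)%R. Proof. by rewrite invr_ge0 ltW. Qed.

Lemma poweR_le (x y : \bar R) (r : R) : (0 <= r)%R -> 0 <= x -> x <= y ->
  x `^ r <= y `^ r.
Proof.
move=> r0 x0 xy; apply: gt0_ler_poweR => //; rewrite in_itv/= leey andbT//.
exact: le_trans xy.
Qed.

Lemma poweRK (x : \bar R) : 0 <= x -> (x `^ p) `^ p^-1 = x.
Proof. by move=> x0; rewrite -poweRrM mulfV// poweRe1. Qed.

Lemma poweRVK (x : \bar R) : 0 <= x -> (x `^ p^-1) `^ p = x.
Proof. by move=> x0; rewrite -poweRrM mulVf// poweRe1. Qed.

Lemma lee_poweRV (x y : \bar R) : 0 <= x -> 0 <= y ->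
  (x <= y `^ p^-1) = (x `^ p <= y).
Proof.
move=> x0 y0; apply/idP/idP => [/(poweR_le (ltW p_gt0) x0)|].
  by rewrite poweRVK.
by move=> /(poweR_le ip_ge0 (poweR_ge0 _ _)); rewrite poweRK.
Qed.

Lemma poweRV_lee (x y : \bar R) : 0 <= x -> 0 <= y ->
  (x `^ p^-1 <= y) = (x <= y `^ p).
Proof.
move=> x0 y0; apply/idP/idP => [/(poweR_le (ltW p_gt0) (poweR_ge0 _ _))|].
  by rewrite poweRVK.
by move=> /(poweR_le ip_ge0 x0); rewrite poweRK.
Qed.

Lemma measurable_poweR_itv a b (f : R -> \bar R) : measurable_fun `[a, b] f ->
  measurable_fun `[a, b] (fun x => f x `^ p).
Proof. by move=> mf; apply: (measurableT_comp (measurable_poweR p)). Qed.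

Lemma Lpnorm_itv_ge0 a b f : 0 <= N a b f.
Proof. exact: poweR_ge0. Qed.

Lemma Lpnorm_itv_le a b f g :
  measurable_fun `[a, b] f -> measurable_fun `[a, b] g ->
  (forall x, (a <= x <= b)%R -> 0 <= f x <= g x) -> N a b f <= N a b g.
Proof.
move=> mf mg fg; apply: poweR_le => //.
  by apply: integral_ge0 => x _; exact: poweR_ge0.
apply: ge0_le_integral => //.
- by move=> x _; exact: poweR_ge0.
- exact: measurable_poweR_itv.
- exact: measurable_poweR_itv.
move=> x; rewrite /= in_itv/= => /fg/andP[f0 ?]; exact: poweR_le (ltW p_gt0) _ _.
Qed.

Lemma Lpnorm_itv_subset a b c d f : measurable_fun `[c, d] f ->
  (c <= a)%R -> (b <= d)%R -> N a b f <= N c d f.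
Proof.
move=> mf ca bd; apply: poweR_le => //.
  by apply: integral_ge0 => x _; exact: poweR_ge0.
apply: ge0_subset_integral => //.
- exact: measurable_poweR_itv.
- by move=> x _; exact: poweR_ge0.
by apply: subset_itv; rewrite bnd_simp.
Qed.

Lemma Lpnorm_itv_triangle a b f g h :
  measurable_fun `[a, b] f -> measurable_fun `[a, b] g ->
  measurable_fun `[a, b] h ->
  (forall x, (a <= x <= b)%R -> 0 <= f x) ->
  (forall x, (a <= x <= b)%R -> 0 <= g x) ->
  (forall x, (a <= x <= b)%R -> 0 <= h x <= f x + g x) ->
  N a b h <= N a b f + N a b g.
Proof.
move=> mf mg mh f0 g0 hfg.
by apply: Lp_triangle => // x; rewrite /= in_itv/= => /[dup]/f0 ? /[dup]/g0 ? /hfg.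
Qed.

Lemma Lpnorm_itv_restrict a b c d f : (c <= a)%R -> (b <= d)%R ->
  N c d (f \_ `[a, b]) = N a b f.
Proof.
move=> ca bd; congr poweR; transitivity (\int[mu]_(x in `[c, d]) ((fun x => f x `^ p) \_ `[a, b]) x).
  apply: eq_integral => x _; rewrite !patchE; case: ifPn => // _.
  by rewrite poweR0r.
rewrite -integral_mkcondr; congr (integral _ _ _).
apply/setIidr; by apply: subset_itv; rewrite bnd_simp.
Qed.

(** Minkowski's inequality for the restrictions of [f] to the two pieces. Their sum dominates [f],
    the point [c] being counted twice. *)
Lemma Lpnorm_itv_split a b c f : measurable_fun `[a, b] f ->
  (forall x, (a <= x <= b)%R -> 0 <= f x) -> (a <= c <= b)%R ->
  N a b f <= N a c f + N c b f.
Proof.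
move=> mf f0 /andP[ac cb].
rewrite -(@Lpnorm_itv_restrict a c a b)// -(@Lpnorm_itv_restrict c b a b)//.
have fE d e x : (a <= x <= b)%R -> 0 <= (f \_ `[d, e]) x.
  by move=> ab; rewrite patchE; case: ifPn => // _; exact: f0.
have mfE d e : (a <= d)%R -> (e <= b)%R -> measurable_fun `[a, b] (f \_ `[d, e]).
  move=> ad eb; apply/measurable_restrict => //.
  by apply: measurable_funS mf => //; apply: subIsetl.
apply: Lpnorm_itv_triangle => //; try exact: mfE; try exact: fE.
move=> x axb; rewrite f0//= !patchE.
have /andP[ax xb] := axb.
have [xc|cx] := leP x c.
  rewrite mem_set/= ?in_itv/= ?ax//; rewrite leeDl//; case: ifPn => // _; exact: f0.
rewrite addeC mem_set/= ?in_itv/= ?(ltW cx)//; rewrite leeDl//; case: ifPn => // _; exact: f0.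
Qed.

Lemma Lpnorm_itv_shift a b h f : measurable_fun `[a, b] f ->
  N (a + h) (b + h) (fun x => f (x - h)%R) = N a b f.
Proof.
move=> mf; congr poweR.
rewrite (_ : `[(a + h)%R, (b + h)%R]%classic = shift_fun h @^-1` `[a, b]); last first.
  by apply/seteqP; split => x /=; rewrite !in_itv/= lerBrDr lerBlDr.
rewrite -[LHS](@ge0_integral_pushforward _ _ _ _ _ (shift_fun h) (measurable_shift_fun h) mu `[a, b] (fun x => f x `^ p))//.
- by apply: eq_measure_integral => //= A mA AS; exact: lebesgue_measure_shift.
- exact: measurable_poweR_itv.
- by move=> x _; exact: poweR_ge0.
Qed.

Lemma Lpnorm_itv_cst a b (c : R) : (0 <= c)%R -> (a <= b)%R ->
  N a b (cst c%:E) = (c * (b - a) `^ p^-1)%:E.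
Proof.
move=> c0 ab; rewrite /Lpnorm_itv [X in X `^ _](_ : _ = (c%:E `^ p) * mu `[a, b]); last first.
  by rewrite -integral_cst.
rewrite lebesgue_measure_itv/= lte_fin.
have -> : (if (a < b)%R then b%:E - a%:E else 0) = (b - a)%R%:E.
  case: ifPn => //; rewrite -leNgt => ba.
  by have -> : a = b; [apply/le_anti; rewrite ab|rewrite subrr].
have c0' : 0 <= c%:E by rewrite lee_fin.
have ba0 : 0 <= (b - a)%:E by rewrite lee_fin subr_ge0.
by rewrite -[(c `^ p)%:E]poweR_EFin (poweRM _ (poweR_ge0 _ _) ba0) poweRK// poweR_EFin -EFinM.
Qed.

Lemma Lpnorm_itv_ub a b f (c : R) : (0 <= c)%R -> (a <= b)%R ->
  measurable_fun `[a, b] f ->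
  (forall x, (a <= x <= b)%R -> 0 <= f x <= c%:E) ->
  N a b f <= (c * (b - a) `^ p^-1)%:E.
Proof.
move=> c0 ab mf fc; rewrite -Lpnorm_itv_cst//; apply: Lpnorm_itv_le => //.
Qed.

Lemma Lpnorm_itv_lb a b f (c : R) : (0 <= c)%R -> (a <= b)%R ->
  measurable_fun `[a, b] f ->
  (forall x, (a <= x <= b)%R -> c%:E <= f x) ->
  (c * (b - a) `^ p^-1)%:E <= N a b f.
Proof.
move=> c0 ab mf fc; rewrite -Lpnorm_itv_cst//; apply: Lpnorm_itv_le => //.
by move=> x /fc ->; rewrite lee_fin c0.
Qed.

(** A bound at arbitrarily late indices is enough for a lower limit. *)
Lemma limn_einf_le (u : (\bar R)^nat) (M : \bar R) :
  (forall n, exists2 k, (n <= k)%N & u k <= M) -> limn_einf u <= M.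
Proof.
move=> uM; rewrite limn_einf_lim (cvg_lim _ (@cvg_einfs_sup _ u))//.
apply: ge_ereal_sup => _ [n _ <-]; have [k nk ukM] := uM n.
by apply: le_trans ukM; apply: ereal_inf_lbound; exists k.
Qed.

Lemma limn_einf_ge (u : (\bar R)^nat) (x : \bar R) : 0 <= x ->
  (forall n, 0 <= u n) ->
  (forall r : R, (0 <= r)%R -> r%:E < x -> exists n, forall k, (n <= k)%N -> r%:E <= u k) ->
  x <= limn_einf u.
Proof.
move=> x0 u0 H; rewrite limn_einf_lim (cvg_lim _ (@cvg_einfs_sup _ u))//.
have key (r : R) : (0 <= r)%R -> r%:E < x -> r%:E <= ereal_sup (range (einfs u)).
  move=> r0 /(H _ r0)[n nr].
  apply: (@le_trans _ _ (einfs u n)); last by apply: ereal_sup_ubound; exists n.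
  by apply: le_ereal_inf_tmp => _ [k /= nk <-]; exact: nr.
have s0 : 0 <= ereal_sup (range (einfs u)).
  apply: (@le_trans _ _ (einfs u 0%N)); last by apply: ereal_sup_ubound; exists 0%N.
  by apply: le_ereal_inf_tmp => _ [k /= nk <-].
case: (ereal_sup _) s0 key => [s| |] // s0 key; last by rewrite leey.
rewrite leNgt; apply/negP => sx.
(* A real strictly between [s] and [x] contradicts [key]; [x] may be infinite, in which case s + 1
   serves. *)
have [r /andP[sr rx]] : exists r : R, s%:E < r%:E < x.
  case: x x0 sx {H key} => [x| |]// x0 sx; last by exists (s + 1)%R; rewrite lte_fin ltrDl ltr01 ltry.
  by exists ((s + x) / 2)%R; rewrite !lte_fin !midf_lt.
have r0 : (0 <= r)%R by rewrite -lee_fin (le_trans s0)// ltW.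
by have := key r r0 rx; rewrite leNgt sr.
Qed.

(** Fatou's lemma for p-th powers. The pointwise hypothesis says that [g] is at most the lower limit
    of the [f k], expressed by real thresholds so that infinite values of [g] are covered. *)
Lemma Lpnorm_itv_fatou a b (f : nat -> R -> \bar R) (g : R -> \bar R) (M : \bar R) :
  (forall n, measurable_fun `[a, b] (f n)) -> measurable_fun `[a, b] g ->
  (forall n x, (a <= x <= b)%R -> 0 <= f n x) ->
  (forall x, (a <= x <= b)%R -> 0 <= g x) ->
  {ae mu, forall x, (a <= x <= b)%R -> forall r : R, (0 <= r)%R -> r%:E < g x ->
    exists n, forall k, (n <= k)%N -> r%:E <= f k x} ->
  (forall n, exists2 k, (n <= k)%N & N a b (f k) <= M) -> N a b g <= M.
Proof.
move=> mf mg f0 g0 H fM.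
have M0 : 0 <= M by have [k _] := fM 0%N; apply: le_trans; exact: Lpnorm_itv_ge0.
rewrite -(poweRK M0); apply: poweR_le => //.
  by apply: integral_ge0 => x _; exact: poweR_ge0.
apply: (@le_trans _ _ (\int[mu]_(x in `[a, b]) limn_einf (fun n => f n x `^ p))).
  apply: ae_ge0_le_integral => //.
  - by move=> x _; exact: poweR_ge0.
  - exact: measurable_poweR_itv.
  - move=> x _; apply: limn_einf_ge => // [n|r r0]; [exact: poweR_ge0|by rewrite lte_fin ltNge r0].
  (* The lower limit is measurable as the opposite of an upper limit of opposites. *)
  - apply: (@eq_measurable_fun _ _ _ _ _ (fun x => - limn_esup (fun n => - (f n x `^ p)))) => //.
    apply: measurableT_comp => //; apply: measurable_fun_limn_esup => n.
    by apply: measurableT_comp => //; exact: measurable_poweR_itv.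
  - apply: (@filterS _ _ (ae_filter_ringOfSetsType mu) _ _ _ H) => x Hx; rewrite /= in_itv/= => xab.
    apply: limn_einf_ge => [|n|r r0 rg]; try exact: poweR_ge0.
    (* A threshold r for p-th powers corresponds to the threshold r^(1/p) for the functions. *)
    have [||n nr] := Hx xab (r `^ p^-1)%R; first exact: powR_ge0.
      by rewrite -poweR_EFin ltNge lee_poweRV ?lee_fin ?g0// -ltNge.
    exists n => k /nr; rewrite -poweR_EFin poweRV_lee ?lee_fin//.
    exact: f0.
apply: le_trans (fatou _ _ _ _) _ => //.
- by move=> n; exact: measurable_poweR_itv.
- by move=> n x _; exact: poweR_ge0.
apply: limn_einf_le => n; have [k nk kM] := fM n; exists k => //.
have /(poweR_le (ltW p_gt0) (Lpnorm_itv_ge0 _ _ _)) := kM.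
by rewrite poweRVK// integral_ge0// => x _; exact: poweR_ge0.
Qed.

Lemma ge0_cvg0 (u : (\bar R)^nat) : (forall n, 0 <= u n) ->
  (forall r : R, (0 < r)%R -> exists n, forall k, (n <= k)%N -> u k <= r%:E) ->
  u @ \oo --> 0.
Proof.
move=> u0 H; apply: limn_esup_le_cvg => //.
rewrite limn_esup_lim (cvg_lim _ (@cvg_esups_inf _ u))//.
apply/lee_addgt0Pr => r r0; rewrite add0e; have [n nr] := H r r0.
apply: (@le_trans _ _ (esups u n)); first by apply: ereal_inf_lbound; exists n.
by apply: ge_ereal_sup => _ [k /= nk <-]; exact: nr.
Qed.

(** Dominated convergence to 0 for the p-th powers, with integrable majorant g^p. *)
Lemma Lpnorm_itv_dominated a b (f : nat -> R -> \bar R) (g : R -> \bar R) :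
  (forall n, measurable_fun `[a, b] (f n)) -> measurable_fun `[a, b] g ->
  (forall n x, (a <= x <= b)%R -> 0 <= f n x <= g x) ->
  N a b g < +oo ->
  {ae mu, forall x, (a <= x <= b)%R -> forall r : R, (0 < r)%R ->
    exists n, forall k, (n <= k)%N -> f k x <= r%:E} ->
  forall r : R, (0 < r)%R -> exists n, forall k, (n <= k)%N -> N a b (f k) < r%:E.
Proof.
move=> mf mg fg gfin H r r0.
have [| | |_ _ /=] := @dominated_convergence _ _ _ mu `[a, b] (measurable_itv _)
  (fun n x => f n x `^ p) (cst 0) (fun x => g x `^ p)
  (fun n => measurable_poweR_itv (mf n)) (measurable_cst _) _ _ _.
- apply: (@filterS _ _ (ae_filter_ringOfSetsType mu) _ _ _ H) => x /[swap] /=; rewrite in_itv/= => xab /(_ xab) {}H.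
  apply: ge0_cvg0 => [n|e e0]; first exact: poweR_ge0.
  have [|n nH] := H (e `^ p^-1)%R; first by rewrite powR_gt0.
  exists n => k /nH; rewrite -poweR_EFin lee_poweRV ?lee_fin ?(ltW e0)//.
  by case/andP: (fg k x xab).
- apply/integrableP; split; first exact: measurable_poweR_itv.
  under eq_integral do rewrite gee0_abs ?poweR_ge0//.
  by apply: lty_poweRy gfin; rewrite invr_eq0.
- apply: aeW => x n; rewrite /= in_itv/= => /(fg n)/andP[f0 ?].
  by rewrite gee0_abs ?poweR_ge0//; exact: poweR_le (ltW p_gt0) _ _.
rewrite integral0 => c.
have rp : 0 < (r `^ p)%:E by rewrite lte_fin powR_gt0.
have [n _ nH] := c _ (open_ereal_lt_ereal rp).
exists n => k /nH /= Hk.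
rewrite ltNge lee_poweRV ?lee_fin ?(ltW r0)// -?ltNge//.
by apply: integral_ge0 => x _; exact: poweR_ge0.
Qed.

End Lpnorm_itv.

(** * Nested families of nonempty sets and measurability of their distances *)

Section level_families.
Context {R : realType} {m : nat}.
Implicit Types (F G : R -> set 'rV[R]_m) (a b c d h : R).

(** Exactly what measurability of the Hausdorff distance requires; shared by cuts, constant
    families, shifted families and the cuts of a limit. *)
Definition level_family F :=
  (forall a, 0 <= a <= 1 -> F a !=set0) /\
  (forall a b, 0 <= a <= b -> b <= 1 -> F b `<=` F a).

Lemma level_family_cst A : A !=set0 -> level_family (fun=> A).
Proof. by move=> A0; split=> [a _|a b _ _]. Qed.

(** Truncation at 0 keeps the shifted level in [0, 1]; on levels at least [h] it changes nothing. *)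
Lemma level_family_shift F h : 0 <= h -> level_family F ->
  level_family (fun a => F (Num.max 0 (a - h))).
Proof.
move=> h0 [F0 FS]; split=> [a a01|a b ab b1].
  by apply: F0; case: (leP 0 (a - h)); lra.
by apply: FS; case: (leP 0 (a - h)); case: (leP 0 (b - h)); lra.
Qed.

Lemma measurable_level F G c d : level_family F -> level_family G ->
  0 <= c -> d <= 1 ->
  measurable_fun (`[c, d] : set R)
    ((fun a => hausdorff_dist (F a) (G a)) : R -> \bar R).
Proof.
move=> [F0 FS] [G0 GS] c0 d1.
apply: measurable_funS (measurable_hausdorff F0 G0 FS GS) => //.
by apply: subset_itv; rewrite bnd_simp.
Qed.

Lemma measurable_level_shift F G h c d : level_family F -> level_family G ->
  0 <= h <= c -> d <= 1 ->
  measurable_fun (`[c, d] : set R)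
    ((fun a => hausdorff_dist (F (a - h)) (G (a - h))) : R -> \bar R).
Proof.
move=> lF lG /andP[h0 hc] d1.
apply: (@eq_measurable_fun _ _ _ _ _
  (fun a => hausdorff_dist (F (Num.max 0 (a - h))) (G (Num.max 0 (a - h))))).
  move=> a; rewrite inE /= in_itv/= => /andP[ca _].
  by rewrite max_r// subr_ge0 (le_trans hc).
by apply: measurable_level; rewrite ?(le_trans h0)//; exact: level_family_shift.
Qed.

Lemma measurable_level_gap F h c d : level_family F -> 0 <= h <= c -> d <= 1 ->
  measurable_fun (`[c, d] : set R)
    ((fun a => hausdorff_dist (F a) (F (a - h))) : R -> \bar R).
Proof.
move=> lF /andP[h0 hc] d1.
apply: (@eq_measurable_fun _ _ _ _ _
  (fun a => hausdorff_dist (F a) (F (Num.max 0 (a - h))))).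
  move=> a; rewrite inE /= in_itv/= => /andP[ca _].
  by rewrite max_r// subr_ge0 (le_trans hc).
by apply: measurable_level; rewrite ?(le_trans h0)//; exact: level_family_shift.
Qed.

End level_families.

(** Denominators start at 2, so for positive c the values never exceed c / 2 and a level c lowered
    by them stays at least c / 2. *)
Lemma divr_nat_small {R : realType} (c x : R) : 0 < x ->
  exists K, forall n, (K <= n)%N -> c / n.+2%:R < x.
Proof.
move=> x0; have [K _ KH] := nbhs_infty_gtr (c / x).
exists K => n /KH /= cn.
rewrite ltr_pdivrMr ?ltr0n// mulrC -ltr_pdivrMr//; apply: lt_trans cn _.
by rewrite ltr_nat ltnS leqnSn.
Qed.

(** * Size and left-continuity of the cuts of a single fuzzy set *)

Section FB_cuts.
Context {R : realType} {m : nat} {p : R} {p1 : 1 <= p}.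
Implicit Types (u v : FBspace m p1) (a b c d h e M : R).
Local Notation mu := lebesgue_measure.
Local Notation N := (Lpnorm_itv p).

Definition cut_norm u a : \bar R := hausdorff_dist (alpha_cut u a) [set 0].

Definition cut_gap u h a : \bar R :=
  hausdorff_dist (alpha_cut u a) (alpha_cut u (a - h)).

Definition cut_dist u v a : \bar R :=
  hausdorff_dist (alpha_cut u a) (alpha_cut v a).

Lemma level_cut u : level_family (alpha_cut u).
Proof. by split=> *; [exact: cut_neq0|exact: cut_homo]. Qed.

Lemma set1_origin_neq0 : [set (0 : 'rV[R]_m)] !=set0.
Proof. by exists 0. Qed.

Lemma measurable_cut_norm u c d : 0 <= c -> d <= 1 ->
  measurable_fun (`[c, d] : set R) (cut_norm u).
Proof. by apply: measurable_level; [exact: level_cut|exact: level_family_cst set1_origin_neq0]. Qed.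

Lemma measurable_cut_dist u v c d : 0 <= c -> d <= 1 ->
  measurable_fun (`[c, d] : set R) (cut_dist u v).
Proof. by apply: measurable_level; exact: level_cut. Qed.

Lemma measurable_cut_gap u h c d : 0 <= h <= c -> d <= 1 ->
  measurable_fun (`[c, d] : set R) (cut_gap u h).
Proof. by apply: measurable_level_gap; exact: level_cut. Qed.

Lemma cut_norm_ge0 u a : 0 <= a <= 1 -> (0 <= cut_norm u a)%E.
Proof. by move=> a01; apply: hausdorff_ge0 set1_origin_neq0; exact: cut_neq0. Qed.

Lemma cut_dist_ge0 u v a : 0 <= a <= 1 -> (0 <= cut_dist u v a)%E.
Proof. by move=> a01; apply: hausdorff_ge0; exact: cut_neq0. Qed.

Lemma cut_gap_ge0 u h a : 0 <= h <= a -> a <= 1 -> (0 <= cut_gap u h a)%E.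
Proof.
by move=> ha a1; apply: hausdorff_ge0; apply: cut_neq0; move: ha a1; lra.
Qed.

Lemma cut_norm_lty u : (N 0 1 (cut_norm u) < +oo)%E.
Proof. by have [] := fuzzy_funP u. Qed.

Lemma cut_norm_homo u a b : 0 <= a <= b -> b <= 1 -> (cut_norm u b <= cut_norm u a)%E.
Proof.
move=> /andP[a0 ab] b1; apply: hausdorff0_mono.
  by apply: cut_neq0; rewrite (le_trans a0 ab).
by apply: cut_homo; rewrite a0.
Qed.

(** Chebyshev's inequality for a nonincreasing function: on [0, a] the norm of the cut is at least
    its value at [a], so a^(1/p) times that value is at most [M]. *)
Lemma cut_norm_le u M a : (N 0 1 (cut_norm u) <= M%:E)%E -> 0 < a <= 1 ->
  (cut_norm u a <= (M / a `^ p^-1)%:E)%E.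
Proof.
move=> uM /andP[a0 a1].
have M0 : 0 <= M by rewrite -lee_fin; apply: le_trans uM; exact: Lpnorm_itv_ge0.
have ap : 0 < a `^ p^-1 by rewrite powR_gt0.
rewrite leNgt; apply/negP => h.
(* The norm of the cut could be infinite at this point, so a real [r] between the claimed bound and
   it is used instead. *)
have [r Mr ru] : exists2 r, M / a `^ p^-1 < r & (r%:E <= cut_norm u a)%E.
  case: (cut_norm u a) h => [s| |]//; first by exists s.
  by exists (M / a `^ p^-1 + 1); rewrite ?ltrDl ?leey.
have r0 : 0 <= r by apply: le_trans (ltW Mr); rewrite divr_ge0// ltW.
have : ((r * (a - 0) `^ p^-1)%:E <= M%:E)%E.
  apply: le_trans uM; apply: (@le_trans _ _ (N 0 a (cut_norm u))); last first.
    by apply: Lpnorm_itv_subset => //; exact: measurable_cut_norm.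
  apply: Lpnorm_itv_lb => //; [exact: ltW|exact: measurable_cut_norm|].
  by move=> x /andP[x0 xa]; apply: le_trans ru _; apply: cut_norm_homo => //; rewrite x0.
by rewrite subr0 lee_fin -ler_pdivlMr// leNgt Mr.
Qed.

Lemma cut_bounded u a : 0 < a <= 1 ->
  exists r, forall x, alpha_cut u a x -> eucl_dist x 0 <= r.
Proof.
move=> a01; have uN : N 0 1 (cut_norm u) \is a fin_num.
  by rewrite ge0_fin_numE ?Lpnorm_itv_ge0// cut_norm_lty.
exists (fine (N 0 1 (cut_norm u)) / a `^ p^-1) => x.
by apply: hausdorff0_ub; apply: cut_norm_le a01; rewrite fineK.
Qed.

Lemma alpha_cutE u a x : 0 < a -> alpha_cut u a x = (a <= u x).
Proof. by move=> a0; rewrite /alpha_cut gt_eqF. Qed.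

Lemma cut_gap_homo u h h' a : 0 <= h <= h' -> h' <= a -> a <= 1 ->
  (cut_gap u h a <= cut_gap u h' a)%E.
Proof.
move=> hh' ha a1; apply: (@hausdorff_nested _ _ (alpha_cut u a)) => //.
- by apply: cut_neq0; move: hh'; lra.
- by apply: cut_homo; move: hh'; lra.
- by apply: cut_homo; move: hh'; lra.
Qed.

(* If the cuts [u]_(a - h) stayed away from [u]_a as h tends to 0, a cluster
   point of witnesses would contradict upper semicontinuity. *)
Lemma cut_gap_small u a e : 0 < a <= 1 -> 0 < e ->
  exists2 d, 0 < d <= a & (cut_gap u d a <= e%:E)%E.
Proof.
move=> /[dup] a01 /andP[a0 a1] e0; apply: contrapT => /forall2NP H.
pose d n : R := a / n.+2%:R.
have n2 n : 0 < n.+2%:R :> R by rewrite ltr0n.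
have d0 n : 0 < d n by rewrite divr_gt0.
have da n : d n <= a / 2 by rewrite /d ler_pM2l// lef_pV2 ?posrE// ler_nat.
have /choice[x xP] n : exists x, alpha_cut u (a - d n) x /\
    forall y, alpha_cut u a y -> e < eucl_dist y x.
  have [|Hn] := H (d n).
    by move=> []; rewrite d0//=; have := da n; lra.
   apply: contrapT => /forallNP Hx; apply: Hn; apply: hausdorff_le.
    move=> y ay; exists y; last by rewrite eucl_distxx ltW.
    by apply: cut_homo ay; have := d0 n; have := da n; lra.
  move=> x dx; apply: contrapT => /forall2NP Hy; apply: (Hx x); split=> // y ay.
  by have [|/negP] := Hy y => //; rewrite -ltNge.
have a201 : 0 < a / 2 <= 1 by lra.
have [r ur] := cut_bounded u a201.
have [n|z zx] := @bounded_cluster _ _ x r.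
  apply: ur; have [+ _] := xP n; apply: cut_homo.
  by have := da n; lra.
have az : alpha_cut u a z.
  rewrite alpha_cutE// leNgt; apply/negP => uza.
  have [_ _ usc _] := fuzzy_funP u.
  have [|b0 ub e1] := @eucl_dist_nbhs _ _ z [set y | u y < (u z + a) / 2].
    by apply: usc; lra.
  have [|K dK] := @divr_nat_small R a ((a - u z) / 2); first by lra.
  have [n Kn xz] := zx _ ub K.
  have := e1 (x n); rewrite eucl_distC => /(_ xz)/= uxn.
  have [+ _] := xP n; rewrite alpha_cutE; last by have := da n; lra.
  by have := dK n Kn; rewrite -/(d n); lra.
have [n _ xz] := zx e e0 0%N.
have [_ /(_ z az)] := xP n.
by rewrite eucl_distC; move: xz; lra.
Qed.


(** Absolute continuity of the integral at 0, by dominated convergence for the restrictions of [f]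
    to [0, 1 / (n + 2)]. *)
Lemma Lpnorm_itv_near0 (f : R -> \bar R) e :
  measurable_fun (`[0, 1] : set R) f ->
  (forall a, 0 <= a <= 1 -> (0 <= f a)%E) -> (N 0 1 f < +oo)%E -> 0 < e ->
  exists2 c, 0 < c < 1 & (N 0 c f < e%:E)%E.
Proof.
move=> mf f0 ff e0.
pose c n : R := n.+2%:R^-1.
have c0 n : 0 < c n by rewrite invr_gt0 ltr0n.
have c1 n : c n < 1 by rewrite invf_lt1 ?ltr0n// ltr1n.
have fcE n a : 0 <= a <= 1 -> (0 <= (f \_ `[0%R, c n]) a <= f a)%E.
  by move=> a01; rewrite patchE; case: ifPn => _; rewrite ?lexx f0.
have [] := @Lpnorm_itv_dominated R p p1 0 1 (fun n => f \_ `[0, c n]) f _ mf fcE ff _ e e0.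
- move=> n; apply/measurable_restrict => //.
  by apply: measurable_funS mf => //; apply: subIsetl.
(* Every positive level eventually leaves the shrinking intervals; only level 0 is exceptional. *)
- exists [set 0]; split; [exact: measurable_set1|exact: lebesgue_measure_set1|].
  move=> a /= H; apply: contrapT => /eqP a0; apply: H => a01 r r0.
  have {}a0 : 0 < a by rewrite lt0r a0; case/andP: a01.
  have [K cK] := @divr_nat_small R 1 a a0.
  exists K => k /cK; rewrite mul1r -/(c k) => ka; rewrite patchE memNset ?lee_fin ?(ltW r0)//=.
  by rewrite in_itv/= => /andP[_]; rewrite leNgt ka.
- move=> n /(_ n (leqnn n)); rewrite Lpnorm_itv_restrict ?(ltW (c1 n))// => H.
  by exists (c n); rewrite ?c0 ?c1.
Qed.

(** Condition (ii) for one fuzzy set. Below a small level [c] the gap is at most the sum of two cut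
    norms with small integral; above [c] the gaps are bounded and tend to 0 pointwise. *)
Lemma Lpnorm_cut_gap_small u e : 0 < e -> exists2 delta, 0 < delta <= 1 &
  forall h, 0 <= h < delta -> (N h 1 (cut_gap u h) < e%:E)%E.
Proof.
move=> e0; have e40 : 0 < e / 4 by rewrite divr_gt0.
have [c /andP[c0 c1] Nc] := Lpnorm_itv_near0 (measurable_cut_norm u (lexx 0) (lexx 1))
  (@cut_norm_ge0 u) (cut_norm_lty u) e40.
pose d n : R := c / n.+2%:R.
have d0 n : 0 < d n by rewrite divr_gt0.
have dc n : d n <= c / 2 by rewrite /d ler_pM2l// lef_pV2 ?posrE// ler_nat.
have c21 : 0 < c / 2 <= 1 by lra.
have oneR : 0 < (1 : R) <= 1 by rewrite ltr01 lexx.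
(* For a >= c and shifts at most c / 2, both cuts in a gap lie between the cuts at levels 1 and c /
   2, so [C] dominates all these gaps. *)
pose C := hausdorff_dist (alpha_cut u 1) (alpha_cut u (c / 2)).
have [r0 ur0] := cut_bounded u c21.
have r00 : 0 <= r0.
  have [|x ux] := @cut_neq0 _ _ _ _ u (c / 2); first by lra.
  by apply: le_trans (ur0 _ ux); exact: eucl_dist_ge0.
have Cr : (C <= (r0 + r0)%:E)%E.
  have n1 : alpha_cut u 1 !=set0 by apply: cut_neq0; lra.
  have n2 : alpha_cut u (c / 2) !=set0 by apply: cut_neq0; lra.
  apply: le_trans (hausdorff_triangle n1 set1_origin_neq0 n2) _; rewrite EFinD; apply: leeD.
    apply: hausdorff0_le => // x x1; apply: ur0; apply: cut_homo x1; lra.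
  by rewrite hausdorffC; apply: hausdorff0_le.
have gap01 n a : c <= a <= 1 -> (0 <= cut_gap u (d n) a <= (r0 + r0)%:E)%E.
  move=> ca; have dn := d0 n; have dcn := dc n.
  rewrite cut_gap_ge0; [|by lra|by lra].
  rewrite /=; apply: le_trans Cr; apply: hausdorff_nested.
  - by apply: cut_neq0; lra.
  - by apply: cut_homo; lra.
  - by apply: cut_homo; lra.
  - by apply: cut_homo; lra.
have mgap n : measurable_fun (`[c, 1] : set R) (cut_gap u (d n)).
  by apply: measurable_cut_gap => //; have := d0 n; have := dc n; lra.
have [n nH] : exists n, forall k, (n <= k)%N -> (N c 1 (cut_gap u (d k)) < (e / 4)%:E)%E.
  apply: (@Lpnorm_itv_dominated R p p1 c 1 _ (cst (r0 + r0)%:E) mgap) => //.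
    by rewrite Lpnorm_itv_cst ?addr_ge0 ?(ltW c1)// ltry.
  apply: aeW => a ca r rpos.
  have [|d' /andP[d'0 d'a] gd'] := @cut_gap_small u a r _ rpos; first by lra.
  have [K dK] := @divr_nat_small R c d' d'0.
  exists K => k /dK; rewrite -/(d k) => dk; apply: le_trans gd'; apply: cut_gap_homo => //.
    by rewrite (ltW (d0 k)) ltW.
  by case/andP: ca.
exists (d n); first by have := d0 n; have := dc n; lra.
move=> h /andP[h0 hd]; have hc : h <= c by have := dc n; lra.
have mgh : measurable_fun (`[h, 1] : set R) (cut_gap u h).
  by apply: measurable_cut_gap; rewrite ?h0 ?lexx.
have gh0 a : h <= a <= 1 -> (0 <= cut_gap u h a)%E.
  by move=> ha; apply: cut_gap_ge0; lra.
apply: (@le_lt_trans _ _ (N h c (cut_gap u h) + N c 1 (cut_gap u h))%E).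
  by apply: Lpnorm_itv_split => //; rewrite hc ltW.
(* Gaps grow with the shift, so the estimate for the shift [d n] covers every smaller [h]. *)
have near1 : (N c 1 (cut_gap u h) <= (e / 4)%:E)%E.
  apply: le_trans (ltW (nH n (leqnn n))); apply: Lpnorm_itv_le => //.
    by apply: measurable_cut_gap => //; rewrite h0 hc.
  move=> a ca; rewrite gh0; last by lra.
  by apply: cut_gap_homo; have := dc n; lra.
suff near0 : (N h c (cut_gap u h) <= (e / 4 + e / 4)%:E)%E.
  by apply: le_lt_trans (leeD near0 near1) _; rewrite -EFinD lte_fin; lra.
apply: (@le_trans _ _ (N h c (cut_norm u) + N h c (fun a => cut_norm u (a - h)))%E).
  apply: Lpnorm_itv_triangle => //.
  - by apply: measurable_cut_norm => //; exact: ltW.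
  - apply: (measurable_level_shift (level_cut u) (level_family_cst set1_origin_neq0)).
      by rewrite h0 lexx.
    exact: ltW.
  - by apply: measurable_cut_gap; rewrite ?h0 ?lexx ?ltW.
  - by move=> a ha; apply: cut_norm_ge0; lra.
  - by move=> a ha; apply: cut_norm_ge0; lra.
  - move=> a ha; rewrite gh0/=; last by lra.
    rewrite /cut_norm [X in (_ <= _ + X)%E]hausdorffC; apply: hausdorff_triangle => //.
    + by apply: cut_neq0; lra.
    + exact: set1_origin_neq0.
    + by apply: cut_neq0; lra.
have -> : N h c (fun a => cut_norm u (a - h)) = N 0 (c - h) (cut_norm u).
  rewrite -(@Lpnorm_itv_shift R p 0 (c - h) h) ?add0r ?subrK//.
  by apply: measurable_cut_norm => //; lra.
have mc : measurable_fun (`[0, c] : set R) (cut_norm u).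
  by apply: measurable_cut_norm => //; exact: ltW.
have H1 : (N h c (cut_norm u) <= N 0 c (cut_norm u))%E by apply: Lpnorm_itv_subset.
have H2 : (N 0 (c - h) (cut_norm u) <= N 0 c (cut_norm u))%E.
  by apply: Lpnorm_itv_subset => //; lra.
by rewrite EFinD; exact: leeD (le_trans H1 (ltW Nc)) (le_trans H2 (ltW Nc)).
Qed.

(** Triangle inequality along [v]_a, [u]_a, [u]_(a-h), [v]_(a-h). The first and last distances each
    contribute at most [dp p u v], the last after a translation of the interval. *)
Lemma Lpnorm_cut_gap_le u v h : 0 <= h <= 1 ->
  (N h 1 (cut_gap v h) <= dp p u v + dp p u v + N h 1 (cut_gap u h))%E.
Proof.
move=> h01; have [h0 h1] := andP h01.
have hh : 0 <= h <= h by rewrite h0 lexx.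
have m1 : measurable_fun (`[h, 1] : set R) (cut_dist u v) by exact: measurable_cut_dist.
have m2 : measurable_fun (`[h, 1] : set R) (fun a => cut_dist u v (a - h)).
  exact: measurable_level_shift (level_cut u) (level_cut v) hh (lexx _).
have mg w : measurable_fun (`[h, 1] : set R) (cut_gap w h) by exact: measurable_cut_gap.
have d1 : (N h 1 (cut_dist u v) <= dp p u v)%E.
  by apply: Lpnorm_itv_subset => //; exact: measurable_cut_dist.
have d2 : (N h 1 (fun a => cut_dist u v (a - h)) <= dp p u v)%E.
  have := @Lpnorm_itv_shift R p 0 (1 - h) h (cut_dist u v).
  rewrite add0r subrK => ->; last by apply: measurable_cut_dist => //; lra.
  by apply: Lpnorm_itv_subset => //; [exact: measurable_cut_dist|lra].
have n0 (w : FBspace m p1) a : 0 <= a <= 1 -> alpha_cut w a !=set0 by exact: cut_neq0.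
apply: (@le_trans _ _ (N h 1 (cut_dist u v) +
  (N h 1 (fun a => cut_dist u v (a - h)) + N h 1 (cut_gap u h)))%E); last first.
  by rewrite -addeA; exact: leeD d1 (leeD d2 (lexx _)).
have sub a : h <= a <= 1 -> (0 <= cut_dist u v (a - h) + cut_gap u h a)%E.
  by move=> ha; apply: adde_ge0; [apply: cut_dist_ge0|apply: cut_gap_ge0]; lra.
have m3 : measurable_fun (`[h, 1] : set R)
    (fun a => (cut_dist u v (a - h) + cut_gap u h a)%E) by exact: emeasurable_funD.
apply: (@le_trans _ _ (N h 1 (cut_dist u v) +
  N h 1 (fun a => cut_dist u v (a - h) + cut_gap u h a))%E).
  apply: Lpnorm_itv_triangle => //.
    by move=> a ha; apply: cut_dist_ge0; lra.
  move=> a ha; rewrite cut_gap_ge0/=; [|by lra|by lra].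
  have [na nah] : (0 <= a <= 1) /\ (0 <= a - h <= 1) by split; lra.
  apply: le_trans (hausdorff_triangle (n0 v _ na) (n0 u _ na) (n0 v _ nah)) _.
  rewrite /cut_dist hausdorffC leeD2l// addeC.
  exact: hausdorff_triangle (n0 u _ na) (n0 u _ nah) (n0 v _ nah).
rewrite leeD2l//; apply: Lpnorm_itv_triangle => //.
- by move=> a ha; apply: cut_dist_ge0; lra.
- by move=> a ha; apply: cut_gap_ge0; lra.
- by move=> a ha; rewrite sub ?lexx.
Qed.

End FB_cuts.

(** * Totally bounded sets satisfy conditions (i) and (ii) *)

Section mean_conditions.
Context {R : realType} {m : nat} {p : R} {p1 : 1 <= p}.
Implicit Types (u v : FBspace m p1) (V : set (FBspace m p1)).
Implicit Types (a b c d h e M : R).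
Local Notation N := (Lpnorm_itv p).

(** Every cut of the indicator on [0, 1] is the singleton of the origin, at level 0 because
    singletons are closed. *)
Lemma dp_origin u : dp p u \1_[set 0%R] = N 0 1 (cut_norm u).
Proof.
congr poweR; apply: eq_integral => a; rewrite inE/= in_itv/= => /andP[a0 a1].
rewrite /cut_norm; congr (hausdorff_dist _ _ `^ p)%E.
have ind (x : 'rV[R]_m) : (\1_[set 0%R] x : R) = (x == 0)%:R.
  by rewrite indicE; case: eqVneq => [->|/eqP x0]; [rewrite mem_set|rewrite memNset].
rewrite /alpha_cut; case: ifPn => [_|aN0].
  rewrite [X in closure X](_ : _ = [set 0]).
    by apply/esym/closure_id; exact/accessible_closed_set1/hausdorff_accessible/norm_hausdorff.
  apply/seteqP; split=> x /=; rewrite ind; last by move=> ->; rewrite eqxx.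
  by case: eqVneq => //; rewrite ltxx.
have {}a0 : 0 < a by rewrite lt0r aN0.
apply/seteqP; split=> x /=; rewrite ind; last by move=> ->; rewrite eqxx.
by case: eqVneq => //; rewrite leNgt a0.
Qed.

Lemma cut_norm_dist_le u v :
  (N 0 1 (cut_norm v) <= dp p u v + N 0 1 (cut_norm u))%E.
Proof.
have n0 (w : FBspace m p1) a : 0 <= a <= 1 -> alpha_cut w a !=set0.
  by exact: cut_neq0.
apply: (Lpnorm_itv_triangle p1) => [||||a a01|a a01].
- by apply: measurable_cut_dist.
- exact: measurable_cut_norm.
- exact: measurable_cut_norm.
- by move=> a a01; exact: cut_dist_ge0.
- exact: cut_norm_ge0.
- rewrite cut_norm_ge0//= /cut_dist (hausdorffC (alpha_cut u a)).
  exact: hausdorff_triangle (n0 v _ a01) (n0 u _ a01) set1_origin_neq0.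
Qed.

Lemma finite_set_lb (T : choiceType) (F : set T) (f : T -> R) :
  finite_set F -> (forall t, 0 < f t) ->
  exists2 d, 0 < d & forall t, F t -> d <= f t.
Proof.
move=> /finite_seqP[s ->] f0; elim: s => [|t s [d d0 ds]]; first by exists 1.
exists (Num.min d (f t)); first by rewrite lt_min d0 f0.
move=> t' /=; rewrite inE => /orP[/eqP ->|/ds]; first by rewrite ge_min lexx orbT.
by rewrite ge_min => ->.
Qed.

Lemma finite_set_ub (T : choiceType) (F : set T) (f : T -> R) :
  finite_set F -> exists2 M, 0 < M & forall t, F t -> f t <= M.
Proof.
move=> /finite_seqP[s ->]; elim: s => [|t s [d d0 ds]]; first by exists 1.
exists (Num.max d (f t)); first by rewrite lt_max d0.
move=> t' /=; rewrite inE => /orP[/eqP ->|/ds]; first by rewrite le_max lexx orbT.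
by rewrite le_max => ->.
Qed.

Lemma totally_bounded_mean_bounded V : totally_bounded V -> mean_bounded V.
Proof.
move=> /(_ 1 ltr01)[F fF VF].
have [M M0 FM] := finite_set_ub (fun u => fine (N 0 1 (cut_norm u))) fF.
exists (1 + M); first by rewrite addr_gt0.
move=> u /VF[c Fc cu]; rewrite dp_origin; apply: le_trans (cut_norm_dist_le c u) _.
rewrite EFinD; apply: leeD; first by rewrite -FB_distE lee_fin ltW.
rewrite -[X in (X <= _)%E]fineK ?lee_fin; first exact: FM.
by rewrite ge0_fin_numE ?Lpnorm_itv_ge0// cut_norm_lty.
Qed.

Lemma totally_bounded_equi_left_continuous V :
  totally_bounded V -> mean_equi_left_continuous V.
Proof.
move=> tV e e0; have e40 : 0 < e / 4 by rewrite divr_gt0.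
have [F fF VF] := tV _ e40.
have /choice[f fP] u : exists d, 0 < d <= 1 /\
    forall h, 0 <= h < d -> (N h 1 (cut_gap u h) < (e / 4)%:E)%E.
  by have [d d01 dP] := Lpnorm_cut_gap_small u e40; exists d.
(* One delta for all of [V]: the least of those of the finitely many centres. Two distances to a
   centre and the gap of the centre cost e / 4 each. *)
have [|d d0 dF] := @finite_set_lb _ F f fF.
  by move=> u; have [/andP[]] := fP u.
exists d => // h /andP[h0 hd] v /VF[c Fc cv].
have [c01 cP] := fP c.
have hfc : h < f c by apply: lt_le_trans hd (dF _ Fc).
have h01 : 0 <= h <= 1 by move: c01 hfc; lra.
apply: le_lt_trans (Lpnorm_cut_gap_le c v h01) _.
have gc : (N h 1 (cut_gap c h) <= (e / 4)%:E)%E by apply/ltW/cP; rewrite h0.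
have dcv : (dp p c v <= (e / 4)%:E)%E by rewrite -FB_distE lee_fin; exact: ltW cv.
apply: le_lt_trans (leeD (leeD dcv dcv) gc) _.
by rewrite -!EFinD lte_fin; lra.
Qed.

End mean_conditions.

(** * Conditions (i) and (ii) yield finite nets *)

Section mean_conditions_totally_bounded.
Context {R : realType} {m : nat} {p : R} {p1 : 1 <= p}.
Implicit Types (u v : FBspace m p1) (V : set (FBspace m p1)).
Implicit Types (a b c d h e M : R).
Local Notation N := (Lpnorm_itv p).

(** One representative in [W] is chosen for each of the finitely many values of [f]; values not
    taken on [W] receive the default [t0]. *)
Lemma finite_signature (T : choiceType) (I : finType) (f : T -> I) (W : set T) :
  exists2 F, finite_set F /\ F `<=` W &
    forall t, W t -> exists2 c, F c & f c = f t.
Proof.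
have [->|/set0P[t0 Wt0]] := eqVneq W set0.
  by exists set0 => //; split=> //; exact: finite_set0.
have /choice[g gP] i : exists c : T, W c /\ ((exists2 t : T, W t & f t = i) -> f c = i).
  have [[t Wt ui]|nu] := pselect (exists2 t, W t & f t = i); first by exists t.
  by exists t0; split.
exists (g @` setT).
  by split; [exact/finite_image/finite_finset|move=> _ [i _ <-]; case: (gP i)].
by move=> t Wt; exists (g (f t)); [exists (f t)|case: (gP (f t)) => _; apply; exists t].
Qed.

(** Bounded sets that come within e of the same net points are close: each point passes through a
    net point to the other set. *)
Lemma hausdorff_net_le (A B : set 'rV[R]_m) (s : seq 'rV[R]_m) r e :
  (forall x, eucl_dist x 0 <= r -> exists2 g, g \in s & eucl_dist x g < e) ->
  (forall x, A x -> eucl_dist x 0 <= r) -> (forall x, B x -> eucl_dist x 0 <= r) ->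
  (forall g, g \in s -> (exists2 x, A x & eucl_dist x g < e) <->
                        (exists2 x, B x & eucl_dist x g < e)) ->
  (hausdorff_dist A B <= (e + e)%:E)%E.
Proof.
move=> net Ar Br AB.
have key C D : (forall x, C x -> eucl_dist x 0 <= r) ->
    (forall g, g \in s -> (exists2 x, C x & eucl_dist x g < e) ->
                          (exists2 x, D x & eucl_dist x g < e)) ->
    forall x, C x -> exists2 y, D y & eucl_dist x y <= e + e.
  move=> Cr CD x Cx; have [g gs xg] := net _ (Cr _ Cx).
  have [|y Dy yg] := CD g gs; first by exists x.
  exists y => //; apply: le_trans (eucl_dist_triangle g x y) _.
  by rewrite lerD ?ltW// eucl_distC.
apply: hausdorff_le; first by apply: key => // g /AB[].
move=> b Bb; have [|a Aa ab] := key B A Br _ b Bb; first by move=> g /AB[].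
by exists a => //; rewrite eucl_distC.
Qed.

(* The L^p norm over [0, h] is moved by a shift of length s >> h to [s, s + h],
   where the cuts are bounded by M / s^(1/p). *)
Lemma cut_norm_near0 u M e s h : 0 < s -> 0 <= h -> s + h <= 1 ->
  (N 0 1 (cut_norm u) <= M%:E)%E -> (N s 1 (cut_gap u s) <= e%:E)%E ->
  (N 0 h (cut_norm u) <= (M / s `^ p^-1 * h `^ p^-1 + e)%:E)%E.
Proof.
move=> s0 h0 sh uM ue; have ss : 0 <= s <= s by rewrite lexx ltW.
have M0 : 0 <= M by rewrite -lee_fin; apply: le_trans uM; exact: Lpnorm_itv_ge0.
have := @Lpnorm_itv_shift R p 0 h s (cut_norm u).
rewrite add0r addrC => <-; last by apply: measurable_cut_norm => //; lra.
have n0 a : 0 <= a <= 1 -> alpha_cut u a !=set0 by exact: cut_neq0.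
have mN : measurable_fun (`[s, s + h] : set R) (cut_norm u).
  by apply: measurable_cut_norm => //; exact: ltW.
have mG : measurable_fun (`[s, s + h] : set R) (cut_gap u s) by exact: measurable_cut_gap.
apply: (@le_trans _ _ (N s (s + h) (cut_norm u) + N s (s + h) (cut_gap u s))%E).
  apply: (Lpnorm_itv_triangle p1) => [|||a ha|a ha|a ha] //.
  - exact: measurable_level_shift (level_cut u) (level_family_cst set1_origin_neq0) ss sh.
  - by apply: cut_norm_ge0; lra.
  - by apply: cut_gap_ge0; lra.
  - rewrite cut_norm_ge0/=; last by lra.
    rewrite addeC /cut_gap hausdorffC.
    by apply: hausdorff_triangle set1_origin_neq0; apply: n0; lra.
rewrite EFinD; apply: leeD; last first.
  by apply: le_trans (Lpnorm_itv_subset p1 _ _ _) ue => //; exact: measurable_cut_gap.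
rewrite -[X in (_ * X `^ p^-1)%:E](_ : s + h - s = h); last by rewrite addrAC subrr add0r.
apply: (Lpnorm_itv_ub p1) => [||//|a /andP[sa ah]].
- by rewrite divr_ge0// powR_ge0.
- by rewrite lerDl.
rewrite cut_norm_ge0/=; last by lra.
apply: le_trans (@cut_norm_homo _ _ _ _ u s a _ _) _; [by lra|by lra|].
by apply: cut_norm_le => //; lra.
Qed.

(** Elements of [V] with the same finite signature of cuts are at distance less than e, so one
    representative per signature is a net. Its centres lie in [V], hence in any subspace that
    contains [V]. *)
Lemma mean_conditions_net V e : mean_bounded V -> mean_equi_left_continuous V ->
  0 < e ->
  exists2 F, finite_set F /\ F `<=` V &
    forall u, V u -> exists2 c, F c & (dp p c u < e%:E)%E.
Proof.
(* The levels in [0, h] and those in [h, 1] will each cost four times [e'], in all eight tenths of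
   e. *)
move=> [M M0 VM] Vlc e0; pose e' := e / 10.
have e'0 : 0 < e' by rewrite divr_gt0.
have [d d0 dV] := Vlc _ e'0.
(* Below [d], for equi-left-continuity at shift [s], and at most 1 / 2, so that s + h <= 1 once h <
   s. *)
pose s := Num.min d 1 / 2.
have s0 : 0 < s by rewrite divr_gt0// lt_min d0 ltr01.
have sd : s < d.
  rewrite /s ltr_pdivrMr// (@le_lt_trans _ _ d)//; first by rewrite ge_min lexx.
  by rewrite mulr_natr mulr2n ltrDl.
have s1 : s <= 1 / 2 by rewrite /s ler_pM2r// ge_min lexx orbT.
have sp : 0 < s `^ p^-1 by rewrite powR_gt0.
(* Solves M / s^(1/p) * t^(1/p) = e', so that for h < t the shifted part of the norm over [0, h]
   costs at most e'. *)
pose t := (e' * s `^ p^-1 / M) `^ p.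
have t0 : 0 < t by rewrite powR_gt0// divr_gt0// mulr_gt0.
have [|K0 /(_ K0 (leqnn K0))] := @divr_nat_small R 1 (Num.min s t).
  by rewrite lt_min s0.
set K := K0.+2; set h := 1 / K%:R; rewrite lt_min => /andP[hs ht].
have KR : 0 < K%:R :> R by rewrite ltr0n.
have Kh : K%:R * h = 1 by rewrite /h mul1r divff// gt_eqF.
have h0 : 0 < h by rewrite divr_gt0.
have h1 : h < 1 by lra.
have hp : M / s `^ p^-1 * h `^ p^-1 <= e'.
  rewrite mulrAC ler_pdivrMr// mulrC -ler_pdivlMr//.
  have p0 : 0 < p by exact: lt_le_trans p1.
  have -> : e' * s `^ p^-1 / M = t `^ p^-1.
    by rewrite /t -powRrM mulfV ?gt_eqF// powRr1// divr_ge0 ?mulr_ge0// ltW.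
  by apply: ge0_ler_powR; rewrite ?nnegrE ?invr_ge0 ?ltW.
pose r := M / h `^ p^-1.
have [G netG] := @bounded_net R m r e' e'0.
have VN u : V u -> (N 0 1 (cut_norm u) <= M%:E)%E by rewrite -dp_origin; exact: VM.
have Vr u a x : V u -> h <= a <= 1 -> alpha_cut u a x -> eucl_dist x 0 <= r.
  move=> Vu /andP[ha a1] ax; apply: (@hausdorff0_ub _ _ (alpha_cut u a)) ax.
  apply: le_trans (@cut_norm_homo _ _ _ _ u h a _ a1) _; first by lra.
  by apply: cut_norm_le (VN u Vu) _; lra.
(* The levels h, 2h, ..., Kh = 1. Level 0 is left out because the bound on the cuts degenerates
   there. *)
pose lev (k : 'I_K) : R := k.+1%:R * h.
have lev1 k : h <= lev k <= 1.
  apply/andP; split; first by rewrite ler_peMl ?(ltW h0)// ler1n.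
  by rewrite -[leRHS]Kh ler_pM2r// ler_nat ltn_ord.
(* For each level and each net point, the signature records whether the cut comes within e' of that
   point. *)
pose sig u := [ffun kj : 'I_K * 'I_(size G) =>
  `[< exists2 x, alpha_cut u (lev kj.1) x & eucl_dist x (tnth (in_tuple G) kj.2) < e' >]].
have [F [fF FV] FS] := finite_signature sig V.
exists F => // u Vu; have [c Fc cu] := FS u Vu; exists c => //.
have Vc := FV _ Fc.
have near k : (hausdorff_dist (alpha_cut c (lev k)) (alpha_cut u (lev k)) <= (e' + e')%:E)%E.
  apply: (@hausdorff_net_le _ _ G r) => // [x|x|g /(nthP 0)[j jG <-]].
  - exact: Vr.
  - exact: Vr.
  have := congr1 (fun f : {ffun _ -> bool} => f (k, Ordinal jG)) cu.
  rewrite !ffunE/= (tnth_nth 0)/= => H; split => /asboolP.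
    by rewrite H => /asboolP.
  by rewrite -H => /asboolP.
(* The node is h times the integer part q of a / h; the index is q - 1 since [lev] starts at h. *)
have nodes a : h <= a <= 1 -> exists k, a - h <= lev k <= a.
  move=> /andP[ha a1]; have ah0 : 0 <= a / h by rewrite divr_ge0 ?(ltW h0)// (le_trans (ltW h0)).
  have := truncn_itv ah0; set q := Num.truncn (a / h) => /andP[qa aq].
  have q0 : (0 < q)%N.
    rewrite -(ltr_nat R) -(ltrD2r 1) add0r natr1; apply: le_lt_trans aq.
    by rewrite ler_pdivlMr// mul1r.
  have qK : (q.-1 < K)%N.
    rewrite prednK// -(ler_nat R); apply: le_trans qa _.
    by rewrite ler_pdivrMr// Kh.
  exists (Ordinal qK); rewrite /lev/= prednK//.
  rewrite -ler_pdivlMr// qa andbT lerBlDr -[X in _ + X]mul1r -mulrDl natr1.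
  by rewrite -ler_pdivrMr// ltW.
have hh : 0 <= h <= h by rewrite lexx ltW.
have mG (w : FBspace m p1) : measurable_fun (`[h, 1] : set R) (cut_gap w h).
  exact: measurable_cut_gap.
have n0 (w : FBspace m p1) a : 0 <= a <= 1 -> alpha_cut w a !=set0.
  exact: cut_neq0.
have gapE w a : V w -> h <= a <= 1 -> (0 <= cut_gap w h a)%E.
  by move=> _ ha; apply: cut_gap_ge0; lra.
(* From [c]_a to [c] at the node, to [u] at the node, to [u]_a; the node lies in [a - h, a], so the
   outer steps are bounded by gaps. *)
have pt a : h <= a <= 1 ->
    (cut_dist c u a <= cut_gap c h a + (e' + e')%:E + cut_gap u h a)%E.
  move=> ha; have [k /andP[k1 k2]] := nodes a ha; have kl := lev1 k.
  have nb (w : FBspace m p1) : (hausdorff_dist (alpha_cut w a) (alpha_cut w (lev k)) <= cut_gap w h a)%E.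
    apply: hausdorff_nested => //.
    - by apply: n0; lra.
    - by apply: cut_homo; lra.
    - by apply: cut_homo; lra.
  have [nca nua] : alpha_cut c a !=set0 /\ alpha_cut u a !=set0.
    by split; apply: n0; lra.
  have [nck nuk] : alpha_cut c (lev k) !=set0 /\ alpha_cut u (lev k) !=set0.
    by split; apply: n0; lra.
  apply: le_trans (hausdorff_triangle nca nuk nua) _; apply: leeD; last first.
    by rewrite hausdorffC.
  by apply: le_trans (hausdorff_triangle nca nck nuk) _; exact: leeD (nb c) (near k).
have far : (N h 1 (cut_dist c u) <= (e' + (e' + e') + e')%:E)%E.
  have gapN w : V w -> (N h 1 (cut_gap w h) <= e'%:E)%E.
    move=> Vw; apply/ltW/dV => //; rewrite ltW//=.
    exact: lt_trans hs sd.
  have mC : measurable_fun (`[h, 1] : set R) (cst (e' + e')%:E : R -> \bar R) by [].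
  have mS : measurable_fun (`[h, 1] : set R)
      ((fun a => cut_gap c h a + (e' + e')%:E)%E : R -> \bar R).
    exact: emeasurable_funD.
  have mD : measurable_fun (`[h, 1] : set R) (cut_dist c u).
    by apply: measurable_cut_dist => //; exact: ltW.
  have e20 : 0 <= e' + e' by rewrite addr_ge0 ?(ltW e'0).
  have S0 a : h <= a <= 1 -> (0 <= cut_gap c h a + (e' + e')%:E)%E.
    by move=> ha; apply: adde_ge0; [exact: gapE|rewrite lee_fin].
  have C1 : (N h 1 (cst (e' + e')%:E) <= (e' + e')%:E)%E.
    rewrite Lpnorm_itv_cst ?(ltW h1)// lee_fin ler_piMr//.
    rewrite [leRHS](_ : 1 = 1 `^ p^-1); last by rewrite powR1.
    have ip0 : 0 <= p^-1 by rewrite invr_ge0 (le_trans ler01).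
    by apply: ge0_ler_powR; rewrite ?nnegrE//; lra.
  apply: (@le_trans _ _ (N h 1 (fun a => cut_gap c h a + (e' + e')%:E)%E + N h 1 (cut_gap u h))%E).
    apply: (Lpnorm_itv_triangle p1 mS (mG u) mD) => a ha; first exact: S0.
      exact: gapE.
    by rewrite pt// cut_dist_ge0//; lra.
  rewrite [X in (_ <= X)%E]EFinD; apply: leeD (gapN u Vu).
  apply: (@le_trans _ _ (N h 1 (cut_gap c h) + N h 1 (cst (e' + e')%:E))%E).
    apply: (Lpnorm_itv_triangle p1 (mG c) mC mS) => a ha; first exact: gapE.
      by rewrite lee_fin.
    by rewrite S0//= lexx.
  by rewrite [X in (_ <= X)%E]EFinD; exact: leeD (gapN c Vc) C1.
have close : (N 0 h (cut_dist c u) <= (e' + e' + (e' + e'))%:E)%E.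
  have nrm w : V w -> (N 0 h (cut_norm w) <= (e' + e')%:E)%E.
    move=> Vw; apply: (@le_trans _ _ (M / s `^ p^-1 * h `^ p^-1 + e')%:E); last first.
      by rewrite lee_fin lerD2r.
    apply: cut_norm_near0 => //; [exact: ltW|by lra|exact: VN|].
    by apply/ltW/dV => //; rewrite ltW.
  have mN (w : FBspace m p1) : measurable_fun (`[0, h] : set R) (cut_norm w).
    by apply: measurable_cut_norm => //; exact: ltW.
  apply: (@le_trans _ _ (N 0 h (cut_norm c) + N 0 h (cut_norm u))%E); last first.
    by rewrite [X in (_ <= X)%E]EFinD; exact: leeD (nrm c Vc) (nrm u Vu).
  apply: (Lpnorm_itv_triangle p1 (mN c) (mN u)) => [|a ha|a ha|a ha].
  - by apply: measurable_cut_dist => //; exact: ltW.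
  - by apply: cut_norm_ge0; lra.
  - by apply: cut_norm_ge0; lra.
  rewrite cut_dist_ge0/=; last by lra.
  rewrite /cut_norm [X in (_ <= _ + X)%E]hausdorffC.
  by apply: hausdorff_triangle; [apply: n0|exact: set1_origin_neq0|apply: n0]; lra.
have sp1 : (dp p c u <= N 0 h (cut_dist c u) + N h 1 (cut_dist c u))%E.
  apply: (Lpnorm_itv_split p1) => [|a ha|]; first exact: measurable_cut_dist.
    by apply: cut_dist_ge0.
  by rewrite !ltW.
apply: le_lt_trans sp1 _; apply: le_lt_trans (leeD close far) _.
by rewrite -EFinD lte_fin /e'; lra.
Qed.

End mean_conditions_totally_bounded.

(** * The limit function of a sequence whose cuts are Cauchy at almost every level *)

Section limit.
Context {R : realType} {m : nat} {p : R} {p1 : 1 <= p}.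
Variable s : nat -> FBspace m p1.
Implicit Types (x y z : 'rV[R]_m) (a b c d h e r M : R).
Local Notation N := (Lpnorm_itv p).
Local Notation mu := lebesgue_measure.

(* The Kuratowski lower limit of the cuts; unlike the Hausdorff limit it exists
   at every level. *)
Definition lower_cut a : set 'rV[R]_m :=
  [set x | forall e, 0 < e -> exists n, forall k, (n <= k)%N ->
    exists2 y, alpha_cut (s k) a y & eucl_dist y x < e].

Definition cauchy_cut a := forall e, 0 < e -> exists n, forall k l,
  (n <= k)%N -> (n <= l)%N ->
  (hausdorff_dist (alpha_cut (s k) a) (alpha_cut (s l) a) < e%:E)%E.

Lemma lower_cut_homo a b : 0 <= a <= b -> lower_cut b `<=` lower_cut a.
Proof.
move=> ab x bx e e0; have [n nH] := bx e e0; exists n => k /nH[y yb yx].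
by exists y => //; exact: cut_homo yb.
Qed.

Lemma lower_cut_closed a z :
  (forall e, 0 < e -> exists2 x, lower_cut a x & eucl_dist x z < e) ->
  lower_cut a z.
Proof.
move=> H e e0; have [x ax xz] := H _ (divr_gt0 e0 (@ltr0n R 2)).
have [n nH] := ax _ (divr_gt0 e0 (@ltr0n R 2)); exists n => k /nH[y ya yx].
exists y => //; apply: le_lt_trans (eucl_dist_triangle x y z) _.
by rewrite (splitr e) ltrD.
Qed.

(** At a Cauchy level the upper limit is contained in the lower one: a point approached at
    arbitrarily late indices is approached at all late indices. *)
Lemma cauchy_cut_cluster a z : cauchy_cut a ->
  (forall e, 0 < e -> forall K, exists2 n, (K <= n)%N &
    exists2 y, alpha_cut (s n) a y & eucl_dist y z < e) ->
  lower_cut a z.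
Proof.
move=> ca H e e0; have e20 : 0 < e / 2 by rewrite divr_gt0.
have [n nH] := ca _ e20; exists n => k nk.
have [l nl [y yl yz]] := H _ e20 n.
have [x xk xy] := hausdorff_lt_r (nH k l nk nl) yl.
exists x => //; apply: le_lt_trans (eucl_dist_triangle y x z) _.
by rewrite (splitr e) ltrD.
Qed.

(** A point of a late cut has neighbours within e / 2 in all later cuts; a cluster point of these
    neighbours lies in the lower limit. *)
Lemma cauchy_cut_lower a e : cauchy_cut a -> 0 < e ->
  exists n, forall k, (n <= k)%N -> forall y, alpha_cut (s k) a y ->
    exists2 x, lower_cut a x & eucl_dist y x <= e.
Proof.
move=> ca e0; have e20 : 0 < e / 2 by rewrite divr_gt0.
have [n nH] := ca _ e20; exists n => k nk y yk.
have /choice[z zP] j : exists z, alpha_cut (s (n + j)%N) a z /\ eucl_dist y z < e / 2.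
  have [z zj yz] := hausdorff_lt_l (nH k (n + j)%N nk (leq_addr _ _)) yk.
  by exists z.
have [j|x xz] := @bounded_cluster _ _ z (e / 2 + eucl_dist y 0).
  apply: le_trans (eucl_dist_triangle y (z j) 0) _; rewrite lerD2r eucl_distC.
  by apply: ltW; case: (zP j).
exists x.
  apply: cauchy_cut_cluster => // d d0 K; have [j Kj zx] := xz _ d0 K.
  by exists (n + j)%N; [rewrite (leq_trans Kj)// leq_addl|exists (z j) => //; case: (zP j)].
have [j _ zx] := xz _ e20 0%N.
apply: le_trans (eucl_dist_triangle (z j) y x) _; rewrite (splitr e).
by apply: lerD; apply: ltW => //; case: (zP j).
Qed.

Lemma cauchy_cut_neq0 a : 0 <= a <= 1 -> cauchy_cut a -> lower_cut a !=set0.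
Proof.
move=> a01 ca; have [n /(_ n (leqnn n)) nH] := cauchy_cut_lower ca ltr01.
have [y yn] := cut_neq0 (s n) a01.
by have [x xa _] := nH y yn; exists x.
Qed.

Lemma cauchy_cut_cvg a e : 0 <= a <= 1 -> cauchy_cut a -> 0 < e ->
  exists n, forall k, (n <= k)%N ->
    (hausdorff_dist (alpha_cut (s k) a) (lower_cut a) <= e%:E)%E.
Proof.
move=> a01 ca e0; have e20 : 0 < e / 2 by rewrite divr_gt0.
have [n1 n1H] := cauchy_cut_lower ca e0.
have [n2 n2H] := ca _ e20.
exists (maxn n1 n2) => k; rewrite geq_max => /andP[n1k n2k].
apply: hausdorff_le => [y yk|x xa]; first exact: n1H yk.
have [n3 n3H] := xa _ e20.
have [z zl zx] := n3H _ (leq_maxl n3 n2).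
have [y yk yz] := hausdorff_lt_r (n2H k _ n2k (leq_maxr n3 n2)) zl.
exists y => //; apply: le_trans (eucl_dist_triangle z y x) _.
by rewrite (splitr e); apply: lerD; exact: ltW.
Qed.

Variable M : R.
Hypothesis sM : forall k, (N 0 1 (cut_norm (s k)) <= M%:E)%E.
Hypothesis cs : {ae mu, forall a, 0 <= a <= 1 -> cauchy_cut a}.

Lemma lower_cut_bounded a x : 0 < a <= 1 -> lower_cut a x ->
  eucl_dist x 0 <= M / a `^ p^-1 + 1.
Proof.
move=> a01 ax; have [n /(_ n (leqnn n))[y yn yx]] := ax 1 ltr01.
apply: le_trans (eucl_dist_triangle y x 0) _; rewrite addrC lerD//.
  exact: hausdorff0_ub (cut_norm_le (sM n) a01) yn.
by rewrite eucl_distC ltW.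
Qed.

(** The exceptional levels form a null set, which contains no interval. *)
Lemma cauchy_cut_dense a b : 0 <= a < b -> b <= 1 ->
  exists2 c, a < c < b & cauchy_cut c.
Proof.
move=> /andP[a0 ab] b1; have [Z [mZ Z0 subZ]] := cs.
apply: contrapT => /forall2NP H.
have : (mu (`]a, b[ : set R) <= mu Z)%E.
  apply: le_measure; rewrite ?inE//.
  move=> c /=; rewrite in_itv/= => acb; apply: subZ => /= cc.
  by have [|] := H c => //; apply; apply: cc; lra.
rewrite Z0 lebesgue_measure_itv/= lte_fin ab -EFinB lee_fin.
by rewrite leNgt subr_gt0 ab.
Qed.

(** Level 0 is always included, so that the supremum is over a nonempty set and equals 0 outside all
    lower limits at positive levels. *)
Definition limit_levels x : set R :=
  [set a | a = 0 \/ 0 < a <= 1 /\ lower_cut a x].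

Definition limit_fun x : R := sup (limit_levels x).

Let limit_has_sup x : has_sup (limit_levels x).
Proof.
split; first by exists 0; left.
by exists 1 => a [->|[/andP[_ ->]]].
Qed.

Lemma limit_fun01 x : 0 <= limit_fun x <= 1.
Proof.
apply/andP; split.
  by apply: sup_upper_bound => //; left.
apply: sup_le_ub; first by exists 0; left.
by move=> a [->|[/andP[_ ->]]].
Qed.

Lemma limit_funP a x : 0 < a <= 1 ->
  a <= limit_fun x <-> forall b, 0 < b < a -> lower_cut b x.
Proof.
move=> /andP[a0 a1]; split=> [ax b /andP[b0 ba]|H].
  have ab0 : 0 < a - b by rewrite subr_gt0.
  have [c cx bc] := sup_adherent ab0 (limit_has_sup x).
  have {}bc : b < c by apply: le_lt_trans bc; rewrite lerBrDr addrC subrK.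
  case: cx bc => [->|[_ xc] bc]; first by lra.
  by apply: lower_cut_homo xc; rewrite !ltW.
rewrite leNgt; apply/negP => xa; have /andP[x0 _] := limit_fun01 x.
pose b := (limit_fun x + a) / 2.
have b0 : 0 < b < a by rewrite /b; lra.
have : b <= limit_fun x.
  apply: sup_upper_bound => //; right; split; [by lra|exact: H].
by rewrite /b; lra.
Qed.

(** Eventually the points lie in the bounded lower limit at level a / 2, so they have a cluster
    point; the closed lower limits at all levels below [a] contain it. *)
Lemma limit_fun_cluster a (z : nat -> 'rV[R]_m) : 0 < a <= 1 ->
  (forall b, 0 < b < a -> exists K, forall n, (K <= n)%N -> lower_cut b (z n)) ->
  exists2 x, a <= limit_fun x & forall e, 0 < e -> forall K, exists2 n, (K <= n)%N &
    eucl_dist (z n) x < e.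
Proof.
move=> a01 H; have a2 : 0 < a / 2 < a by lra.
have a21 : 0 < a / 2 <= 1 by lra.
have [K0 K0H] := H _ a2.
have [n|x xz] := @bounded_cluster _ _ (fun n => z (K0 + n)%N) (M / (a / 2) `^ p^-1 + 1).
  by apply: lower_cut_bounded => //; apply: K0H; exact: leq_addr.
have xz' e : 0 < e -> forall K, exists2 n, (K <= n)%N & eucl_dist (z n) x < e.
  move=> e0 K; have [n Kn zx] := xz e e0 K.
  by exists (K0 + n)%N => //; rewrite (leq_trans Kn)// leq_addl.
exists x => //; apply/limit_funP => // b /H[K KH].
apply: lower_cut_closed => e e0; have [n Kn zx] := xz' e e0 K.
by exists (z n) => //; exact: KH.
Qed.

(** Cauchy levels chosen in (a - a / (n + 2), a) approach [a] from below; [a] itself may be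
    exceptional. *)
Lemma cauchy_cut_seq a : 0 < a <= 1 -> exists c : nat -> R,
  (forall n, 0 < c n < a /\ cauchy_cut (c n)) /\
  forall b, 0 < b < a -> exists K, forall n, (K <= n)%N -> b < c n.
Proof.
move=> /andP[a0 a1].
have /choice[c cP] n : exists c, a - a / n.+2%:R < c < a /\ cauchy_cut c.
  have [||c] := @cauchy_cut_dense (a - a / n.+2%:R) a => //; last by exists c.
  have n0 : 0 < n.+2%:R :> R by rewrite ltr0n.
  rewrite subr_ge0 ler_pdivrMr// ler_peMr ?ler1n ?(ltW a0)//=.
  by rewrite ltrBlDr ltrDl divr_gt0.
exists c; split=> [n|b /andP[b0 ba]].
  have [/andP[c1 c2] cc] := cP n; split=> //; rewrite c2 andbT.
  apply: le_lt_trans c1; rewrite subr_ge0 ler_pdivrMr ?ltr0n//.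
  by rewrite ler_peMr ?ler1n ?(ltW a0).
have ab0 : 0 < a - b by rewrite subr_gt0.
have [K KH] := @divr_nat_small R a (a - b) ab0.
exists K => n /KH h; have [/andP[c1 _] _] := cP n; apply: lt_trans c1.
by rewrite ltrBrDr addrC -ltrBrDr.
Qed.

(** Lower limits are known to be nonempty at Cauchy levels; points taken at such levels tending to 1
    cluster at a point of value 1. *)
Lemma limit_normal : normal_fuzzy limit_fun.
Proof.
have one01 : 0 < (1 : R) <= 1 by lra.
have [c [cP cb]] := cauchy_cut_seq one01.
have /choice[z zP] n : exists z, lower_cut (c n) z.
  by have [c01 cc] := cP n; have [|z] := @cauchy_cut_neq0 (c n) _ cc; [lra|exists z].
have [b b01|x x1 _] := @limit_fun_cluster 1 z one01.
  have [K KH] := cb b b01; exists K => n /KH bc.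
  by apply: lower_cut_homo (zP n); lra.
by exists x; apply/le_anti; rewrite x1 andbT; case/andP: (limit_fun01 x).
Qed.

(** If the value at [x] is below [a], some closed lower limit at a level below [a] misses [x], and
    hence misses a ball around it. *)
Lemma limit_usc : upper_semicontinuous limit_fun.
Proof.
move=> x a xa; change (nbhs x [set y | limit_fun y < a]).
have [a1|a1] := ltP 1 a.
  by apply: filterS filterT => y _; apply: le_lt_trans a1; case/andP: (limit_fun01 y).
have a0 : 0 < a by apply: le_lt_trans xa; case/andP: (limit_fun01 x).
have a01 : 0 < a <= 1 by rewrite a0.
have /existsNP[b /not_implyP[b0 nb]] : ~ forall b, 0 < b < a -> lower_cut b x.
  by move=> /(limit_funP _ a01); rewrite leNgt xa.
have /existsNP[e /not_implyP[e0 ne]] :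
    ~ forall e, 0 < e -> exists2 y, lower_cut b y & eucl_dist y x < e.
  by move=> /lower_cut_closed.
apply: filterS (eucl_ball_nbhs x e0) => y /= yx; rewrite ltNge; apply/negP.
by move=> /(limit_funP _ a01)/(_ b b0) yb; apply: ne; exists y.
Qed.

(** Established before the limit is known to lie in [FB], because the bound on its norm already
    needs measurable distances of its cuts. *)
Lemma level_limit : level_family (alpha_cut limit_fun).
Proof.
split=> [a /andP[a0 a1]|a b /andP[a0 ab] b1].
  have [x ux] := limit_normal; exists x.
  rewrite /alpha_cut; case: ifPn => _; last by rewrite /= ux.
  by apply: subset_closure; rewrite /= ux.
rewrite /alpha_cut; have [b0|b0] := eqVneq b 0.
  by have -> : a = 0 by [apply/eqP; rewrite eq_le a0 -b0 ab]; rewrite eqxx.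
case: ifPn => _ x /= bx; last exact: le_trans bx.
apply: subset_closure => /=; apply: lt_le_trans bx.
by rewrite lt_neqAle eq_sym b0 (le_trans a0).
Qed.

(* A level a where [u]_a exceeds the lower limit is determined by a rational
   ball which meets [u]_a but not the lower limit at a. *)
Lemma limit_cut_countable :
  countable [set a | 0 < a <= 1 /\ ~ (alpha_cut limit_fun a `<=` lower_cut a)].
Proof.
set B := [set a | _].
have /choice[f fP] a : exists nj : nat * nat, B a ->
    (exists2 x, a <= limit_fun x & eucl_dist (ratpt nj.1) x < nj.2.+2%:R^-1) /\
    (forall x, lower_cut a x -> ~ eucl_dist (ratpt nj.1) x < nj.2.+2%:R^-1).
  have [Ba|nBa] := pselect (B a); last by exists (0%N, 0%N).
  have [/andP[a0 a1] /existsNP[x /not_implyP[ax nax]]] := Ba.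
  have /existsNP[e /not_implyP[e0 ne]] :
      ~ forall e, 0 < e -> exists2 y, lower_cut a y & eucl_dist y x < e.
    by move=> /lower_cut_closed.
  have e20 : 0 < e / 2 by rewrite divr_gt0.
  have [j /(_ j (leqnn j)) je] := @divr_nat_small R 1 (e / 2) e20.
  rewrite mul1r in je.
  have j0 : 0 < j.+2%:R^-1 :> R by rewrite invr_gt0 ltr0n.
  have [q xq] := rat_dense x j0.
  have Eq : ratpt (pickle q) = map_mx ratr q :> 'rV[R]_m by rewrite /ratpt pickleK.
  exists (pickle q, j) => _ /=; rewrite Eq; split.
    by exists x; [move: ax; rewrite /alpha_cut gt_eqF|rewrite eucl_distC].
  move=> y ya qy; apply: ne; exists y => //; rewrite eucl_distC.
  apply: le_lt_trans (eucl_dist_triangle (map_mx ratr q) x y) _.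
  by rewrite (splitr e); exact: ltrD (lt_trans xq je) (lt_trans qy je).
apply/countable_injP.
exists (fun a => pickle (f a)).
have key a b : a < b -> B a -> B b -> f a = f b -> False.
  move=> ab /[dup] [[a01 _]] /fP[_ fa] /[dup] [[b01 _]] /fP[[x bx bfx] _] ffe.
  rewrite -ffe in bfx; apply: fa bfx.
  by have /(limit_funP _ b01) := bx; apply; lra.
move=> a b; rewrite !inE => Ba Bb /(pcan_inj pickleK) fab.
by have [ab|ab|//] := ltgtP a b; [case: (key a b)|case: (key b a)].
Qed.

Lemma limit_cut_cvg : {ae mu, forall a, 0 <= a <= 1 -> forall e, 0 < e ->
  exists n, forall k, (n <= k)%N ->
    (hausdorff_dist (alpha_cut (s k) a) (alpha_cut limit_fun a) <= e%:E)%E}.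
Proof.
have nB (B : set R) : countable B -> {ae mu, forall a, ~ B a}.
  move=> cB; exists B; split => //=; first exact: countable_measurable.
    exact: countable_lebesgue_measure0.
  by move=> a /= /contrapT.
(* Three null sets are removed: the levels that are not Cauchy, the countable set where the limit
   cut exceeds the lower limit, and level 0. *)
apply: (@filterS3 _ _ (ae_filter_ringOfSetsType mu) _ _ _ _ _ cs
  (nB _ limit_cut_countable) (nB _ (countable1 0))) => a ca nBa na0 a01 e e0.
have {}ca := ca a01.
have a0 : 0 < a.
  rewrite lt0r; case/andP: a01 => -> _; rewrite andbT; apply/eqP => a0.
  exact: na0.
have a01' : 0 < a <= 1 by rewrite a0; case/andP: a01.
have -> : alpha_cut limit_fun a = lower_cut a.
  apply/seteqP; split.
    by apply: contrapT => H; apply: nBa.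
  move=> x ax; rewrite /alpha_cut gt_eqF//=; apply/limit_funP => // b ba.
  by apply: lower_cut_homo ax; lra.
exact: cauchy_cut_cvg.
Qed.

End limit.

(** * Euclidean distance and convex combinations *)

Section eucl_dist_affine.
Context {R : realType} {m : nat}.
Implicit Types (x y z : 'rV[R]_m) (l e : R).

Lemma eucl_distD2r z x y : eucl_dist (x + z) (y + z) = eucl_dist x y.
Proof.
by congr Num.sqrt; apply: eq_bigr => i _; rewrite !mxE opprD addrACA subrr addr0.
Qed.

Lemma eucl_distZ l x y : 0 <= l -> eucl_dist (l *: x) (l *: y) = l * eucl_dist x y.
Proof.
move=> l0; rewrite /eucl_dist -[X in _ = X * _](ger0_norm l0) -sqrtr_sqr -sqrtrM ?sqr_ge0//.
rewrite mulr_sumr; congr Num.sqrt; apply: eq_bigr => i _.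
by rewrite !mxE -mulrBr exprMn.
Qed.

Lemma eucl_dist_conv_lt l e x y x' y' : 0 <= l <= 1 ->
  eucl_dist x x' < e -> eucl_dist y y' < e ->
  eucl_dist (l *: x + (1 - l) *: y) (l *: x' + (1 - l) *: y') < e.
Proof.
move=> l01 xx' yy'.
apply: le_lt_trans (eucl_dist_triangle (l *: x' + (1 - l) *: y) _ _) _.
rewrite eucl_distD2r ![l *: x' + _]addrC eucl_distD2r !eucl_distZ; [|by lra|by lra].
set d := eucl_dist x x' in xx' *; set d' := eucl_dist y y' in yy' *.
have dd : Num.max d d' < e by rewrite gt_max xx'.
have h1 : l * d <= l * Num.max d d' by apply: ler_wpM2l; [lra|rewrite le_max lexx].
have h2 : (1 - l) * d' <= (1 - l) * Num.max d d'.
  by apply: ler_wpM2l; [lra|rewrite le_max lexx orbT].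
by lra.
Qed.

End eucl_dist_affine.

(** * The limit as a point of the space, and the star and convexity conditions *)

Section limit_fuzzy.
Context {R : realType} {m : nat} {p : R} {p1 : 1 <= p}.
Variable s : nat -> FBspace m p1.
Implicit Types (x y z : 'rV[R]_m) (a b c d h e r l : R).
Local Notation N := (Lpnorm_itv p).
Local Notation mu := lebesgue_measure.
Variable M : R.
Hypothesis sM : forall k, (N 0 1 (cut_norm (s k)) <= M%:E)%E.
Hypothesis cs : {ae mu, forall a, 0 <= a <= 1 -> cauchy_cut s a}.

(** Lower semicontinuity of the distance to [C], in the threshold form that the Fatou lemma takes;
    the distance from [C] to [A] may be infinite. *)
Lemma hausdorff_liminf (A C : set 'rV[R]_m) (B : nat -> set 'rV[R]_m) :
  A !=set0 -> C !=set0 -> (forall k, B k !=set0) ->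
  (forall e, 0 < e -> exists n, forall k, (n <= k)%N ->
    (hausdorff_dist (B k) A <= e%:E)%E) ->
  forall r, (r%:E < hausdorff_dist C A)%E ->
    exists n, forall k, (n <= k)%N -> (r%:E <= hausdorff_dist C (B k))%E.
Proof.
move=> A0 C0 B0 H r rCA.
have [e e0 re] : exists2 e, 0 < e & ((r + e)%:E < hausdorff_dist C A)%E.
  case: (hausdorff_dist C A) rCA => [t| |]//; last by exists 1; rewrite ?ltry.
  by rewrite lte_fin => rt; exists ((t - r) / 2); rewrite ?lte_fin; lra.
have [n nH] := H e e0; exists n => k /nH BA.
rewrite leNgt; apply/negP => /ltW CB.
have := le_trans (hausdorff_triangle C0 (B0 k) A0) (leeD CB BA).
by rewrite -EFinD leNgt re.
Qed.

Let level_lim := level_limit sM cs.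

Lemma limit_FB : FB p (limit_fun s).
Proof.
split; [exact: limit_fun01|exact: limit_normal sM cs|exact: limit_usc|].
apply: (@le_lt_trans _ _ M%:E); last exact: ltry.
have m0 : measurable_fun (`[0, 1] : set R)
    ((fun a => hausdorff_dist (alpha_cut (limit_fun s) a) [set 0%R]) : R -> \bar R).
  by apply: measurable_level => //; exact: level_family_cst set1_origin_neq0.
apply: (@Lpnorm_itv_fatou R p p1 0 1 (fun n => cut_norm (s n)) _ _ _ m0).
- by move=> n; exact: measurable_cut_norm.
- by move=> n a a01; exact: cut_norm_ge0.
- by move=> a a01; apply: hausdorff_ge0 set1_origin_neq0; exact: (proj1 level_lim).
- apply: (@filterS _ _ (ae_filter_ringOfSetsType mu) _ _ _ (limit_cut_cvg cs)).
  move=> a Ha a01 r r0; rewrite hausdorffC => rH.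
  have [||n nH] := hausdorff_liminf _ set1_origin_neq0 _ (Ha a01) rH.
  + exact: (proj1 level_lim).
  + by move=> k; exact: cut_neq0.
  + by exists n => k /nH; rewrite hausdorffC.
- by move=> n; exists n.
Qed.

Definition limit_fuzzy : FBspace m p1 := mkFBspace p1 limit_FB.

(** Fatou with [k] fixed: a bound on the distances from [s k] to all late terms passes to the
    limit. *)
Lemma limit_dp k e : (exists n0, forall n, (n0 <= n)%N -> (dp p (s k) (s n) <= e%:E)%E) ->
  (dp p (s k) limit_fuzzy <= e%:E)%E.
Proof.
move=> [n0 n0H].
have m0 : measurable_fun (`[0, 1] : set R) (cut_dist (s k) limit_fuzzy).
  exact: measurable_cut_dist.
apply: (@Lpnorm_itv_fatou R p p1 0 1 (fun n => cut_dist (s k) (s n)) _ _ _ m0).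
- by move=> n; exact: measurable_cut_dist.
- by move=> n a a01; exact: cut_dist_ge0.
- by move=> a a01; exact: cut_dist_ge0.
- apply: (@filterS _ _ (ae_filter_ringOfSetsType mu) _ _ _ (limit_cut_cvg cs)).
  move=> a Ha a01 r r0 rH.
  apply: (hausdorff_liminf _ _ _ (Ha a01) rH); first exact: (proj1 level_lim).
    exact: cut_neq0.
  by move=> n; exact: cut_neq0.
- move=> n; exists (maxn n n0); first exact: leq_maxl.
  by apply: n0H; exact: leq_maxr.
Qed.

Lemma limit_ge0 x : 0 <= limit_fun s x.
Proof. by case/andP: (limit_fun01 s x). Qed.

Lemma limit_le1 x : limit_fun s x <= 1.
Proof. by case/andP: (limit_fun01 s x). Qed.

Lemma limit_fuzzy_convex : (forall n, fuzzy_convex (s n)) -> fuzzy_convex limit_fuzzy.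
Proof.
move=> sX x y l l01 /=; set a := Num.min _ _.
have [a0|a0] := leP a 0; first exact: le_trans a0 (limit_ge0 _).
have a01 : 0 < a <= 1 by rewrite a0 ge_min limit_le1.
apply/limit_funP => // b ba e e0.
have /(limit_funP s _ a01)/(_ b ba)/(_ e e0)[n1 n1H] : a <= limit_fun s x.
  by rewrite ge_min lexx.
have /(limit_funP s _ a01)/(_ b ba)/(_ e e0)[n2 n2H] : a <= limit_fun s y.
  by rewrite ge_min lexx orbT.
exists (maxn n1 n2) => k; rewrite geq_max => /andP[/n1H[x' xk xx] /n2H[y' yk yy]].
exists (l *: x' + (1 - l) *: y'); last exact: eucl_dist_conv_lt.
have b0 : 0 < b by case/andP: ba.
move: xk yk; rewrite !alpha_cutE// => xk yk.
by apply: le_trans (sX k x' y' l l01); rewrite le_min xk.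
Qed.

Lemma limit_star_shaped0 : (forall n, star_shaped0 (s n)) -> star_shaped0 limit_fuzzy.
Proof.
move=> sX y l l01 /=.
have [a0|a0] := leP (limit_fun s y) 0; first exact: le_trans a0 (limit_ge0 _).
have a01 : 0 < limit_fun s y <= 1 by rewrite a0 limit_le1.
apply/(limit_funP s _ a01) => b ba e e0.
have /(limit_funP s _ a01)/(_ b ba)/(_ e e0)[n nH] := lexx (limit_fun s y).
exists n => k /nH[y' yk yy]; have b0 : 0 < b by case/andP: ba.
exists (l *: y').
  by move: yk; rewrite !alpha_cutE// => /le_trans; apply; exact: sX.
(* A multiple by l is a convex combination with the origin, the centre common to all terms. *)
have /= := @eucl_dist_conv_lt _ _ l e y' 0 y 0 l01 yy.
by rewrite !scaler0 !addr0; apply; rewrite eucl_distxx.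
Qed.

(** The centres approach [x] only at arbitrarily late indices, and so do the combinations built from
    them; at a Cauchy level this already puts the combination in the lower limit. *)
Lemma star_lower_cut c (z : nat -> 'rV[R]_m) x : cauchy_cut s c ->
  (forall n y l, alpha_cut (s n) c y -> 0 <= l <= 1 ->
    alpha_cut (s n) c (l *: y + (1 - l) *: z n)) ->
  (forall e, 0 < e -> forall K, exists2 n, (K <= n)%N & eucl_dist (z n) x < e) ->
  forall y l, lower_cut s c y -> 0 <= l <= 1 -> lower_cut s c (l *: y + (1 - l) *: x).
Proof.
move=> cc sz zx y l yc l01; apply: cauchy_cut_cluster => // e e0 K.
have [n nH] := yc e e0; have [k] := zx e e0 (maxn K n).
rewrite geq_max => /andP[Kk /nH[y' yk yy]] zkx.
exists k => //; exists (l *: y' + (1 - l) *: z k); first exact: sz.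
exact: eucl_dist_conv_lt.
Qed.

Lemma limit_star_shaped : (forall n, star_shaped (s n)) -> star_shaped limit_fuzzy.
Proof.
move=> sX; have /choice[z zP] := sX.
(* The case l = 0 at a point of value 1 shows that the centre has value 1. All centres thus lie in
   cuts at level 1, which are uniformly bounded. *)
have z1 n : s n (z n) = 1.
  have [s01 [x0 x01] _ _] := fuzzy_funP (s n).
  apply/le_anti; rewrite (andP (s01 _)).2/= -x01.
  have := zP n x0 0; rewrite lexx ler01 scale0r add0r subr0 scale1r; exact.
have one01 : 0 < (1 : R) <= 1 by lra.
have [n|x xz] := @bounded_cluster _ _ z (M / 1 `^ p^-1).
  by apply: hausdorff0_ub (cut_norm_le (sM n) one01) _; rewrite alpha_cutE// z1.
exists x => y l l01 /=.
have [a0|a0] := leP (limit_fun s y) 0; first exact: le_trans a0 (limit_ge0 _).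
have a01 : 0 < limit_fun s y <= 1 by rewrite a0 limit_le1.
apply/(limit_funP s _ a01) => b /andP[b0 ba].
(* The star argument runs at a Cauchy level [c] strictly between [b] and the value at [y]. *)
have [||c /andP[bc ca] cc] := @cauchy_cut_dense _ _ _ _ _ cs b (limit_fun s y).
- by rewrite ba ltW.
- by case/andP: a01.
have c0 : 0 < c by exact: lt_trans bc.
apply: (@lower_cut_homo _ _ _ _ s b c); first by rewrite !ltW.
apply: star_lower_cut xz _ _ _ l01 => //.
  by move=> n y' l'; rewrite !alpha_cutE// => cy l'01; apply: le_trans cy _; exact: zP.
have := lexx (limit_fun s y); move=> /(limit_funP s _ a01); apply.
by rewrite c0.
Qed.

Lemma limit_cut_star_shaped :
  (forall n, cut_star_shaped (s n)) -> cut_star_shaped limit_fuzzy.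
Proof.
move=> sX a a01; have /andP[a0 a1] := a01.
(* At a Cauchy level, a cluster point of the centres of the cuts is a centre of the lower limit. *)
have star c : 0 < c <= 1 -> cauchy_cut s c -> exists x, lower_cut s c x /\
    forall y l, lower_cut s c y -> 0 <= l <= 1 -> lower_cut s c (l *: y + (1 - l) *: x).
  move=> c01 cc.
  have /choice[z zP] n : exists z, alpha_cut (s n) c z /\
      forall y, alpha_cut (s n) c y -> forall l, 0 <= l <= 1 ->
        alpha_cut (s n) c (l *: y + (1 - l) *: z).
    by have [z zc zs] := sX n c c01; exists z.
  have [n|x xz] := @bounded_cluster _ _ z (M / c `^ p^-1).
    by apply: hausdorff0_ub (cut_norm_le (sM n) c01) _; case: (zP n).
  exists x; split.
    apply: cauchy_cut_cluster => // e e0 K; have [n Kn zx] := xz e e0 K.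
    by exists n => //; exists (z n) => //; case: (zP n).
  by apply: star_lower_cut xz => // n y l yc l01; have [_] := zP n; apply.
(* Centres at Cauchy levels tending to [a] from below cluster at a centre of the cut at [a]. *)
have [c [cP cb]] := cauchy_cut_seq cs a01.
have /choice[z zP] n : exists z, lower_cut s (c n) z /\
    forall y l, lower_cut s (c n) y -> 0 <= l <= 1 ->
      lower_cut s (c n) (l *: y + (1 - l) *: z).
  by have [c0a cc] := cP n; apply: star cc; lra.
have [b b0|x ax xz] := @limit_fun_cluster _ _ _ _ s M sM a z a01.
  have [K KH] := cb b b0; exists K => n /KH bc.
  have [zc _] := zP n; apply: lower_cut_homo zc; lra.
exists x; first by rewrite alpha_cutE.
move=> y; rewrite alpha_cutE// => ay l l01; rewrite alpha_cutE//.
apply/(limit_funP s _ a01) => b b0; apply: lower_cut_closed => e e0.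
have [K KH] := cb b b0; have [n Kn zx] := xz e e0 K.
have [c0a _] := cP n; have bc := KH n Kn.
exists (l *: y + (1 - l) *: z n).
  have [_ zs] := zP n; apply: (@lower_cut_homo _ _ _ _ s b (c n)); first by lra.
  by apply: zs => //; move/(limit_funP s _ a01): ay; apply.
by apply: eucl_dist_conv_lt => //; rewrite eucl_distxx.
Qed.

End limit_fuzzy.

(** * Rapidly Cauchy sequences have Cauchy cuts at almost every level *)

Section rapidly_cauchy.
Context {R : realType} {m : nat} {p : R} {p1 : 1 <= p}.
Implicit Types (a b c d e M : R).
Local Notation N := (Lpnorm_itv p).
Local Notation mu := lebesgue_measure.
Local Open Scope ereal_scope.

Lemma geometric_chain (D : nat -> nat -> \bar R) (C q : R) :
  (0 <= C)%R -> (0 <= q <= 1 / 2)%R -> (forall n, D n n <= 0) ->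
  (forall n k, D n k.+1 <= D n k + D k k.+1) ->
  (forall n, D n n.+1 <= (C * q ^+ n)%:E) ->
  forall n j, D n (n + j)%N <= (2 * C * q ^+ n)%:E.
Proof.
move=> C0 /andP[q0 q1] D0 Dt Dq n j.
(* The induction needs the sharper telescoping bound: for q <= 1 / 2 each step C q^k is at most 2 C
   q^k - 2 C q^(k+1). *)
apply: (@le_trans _ _ (2 * C * q ^+ n - 2 * C * q ^+ (n + j))%:E); last first.
  by rewrite lee_fin gerBl !mulr_ge0// exprn_ge0.
elim: j => [|j IH]; first by rewrite addn0 subrr.
rewrite addnS; apply: le_trans (Dt _ _) _; apply: le_trans (leeD IH (Dq _)) _.
rewrite -EFinD lee_fin exprS.
have X0 : (0 <= C * q ^+ (n + j))%R by rewrite mulr_ge0// exprn_ge0.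
by nra.
Qed.

Variable s : nat -> FBspace m p1.
Local Notation q := (4^-1 : R)%R.
Hypothesis rs : forall n, (FB_dist (s n) (s n.+1) < q ^+ n)%R.

Lemma rapid_FB_dist n k : (n <= k)%N -> (FB_dist (s n) (s k) <= 2 * q ^+ n)%R.
Proof.
move=> nk; rewrite -(subnKC nk) -lee_fin -[X in (X * _)%R]mulr1.
apply: (geometric_chain (D := fun i j => (FB_dist (s i) (s j))%:E) ler01).
- by rewrite invr_ge0/=; lra.
- by move=> i; have -> : FB_dist (s i) (s i) = 0%R by exact: (@mdistxx R (FBspace m p1)).
- by move=> i j; rewrite -EFinD lee_fin; exact: (@metric_triangle R (FBspace m p1)).
- by move=> i; rewrite mul1r lee_fin ltW.
Qed.

Lemma Lpnorm_itvZ a b (c : R) (f : R -> \bar R) : (0 <= c)%R ->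
  measurable_fun `[a, b] f -> (forall x, (a <= x <= b)%R -> 0 <= f x) ->
  \int[mu]_(x in `[a, b]) ((c%:E * f x) `^ p) =
  (c `^ p)%:E * \int[mu]_(x in `[a, b]) (f x `^ p).
Proof.
move=> c0 mf f0; rewrite -ge0_integralZl//.
- apply: eq_integral => x; rewrite inE/= in_itv/= => /f0 fx.
  by rewrite poweRM ?lee_fin// poweR_EFin.
- exact: measurable_poweR_itv.
- by move=> x _; exact: poweR_ge0.
- by rewrite lee_fin powR_ge0.
Qed.

(** Steps below 4^-k leave room for weights 2^k: the p-th power of the weighted k-th distance has
    integral at most (2^-k)^p <= 2^-k, as p >= 1. The sum of these powers is therefore finite almost
    everywhere. *)
Lemma rapid_cauchy_cut : {ae mu, forall a, (0 <= a <= 1)%R -> cauchy_cut s a}.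
Proof.
have p0 : (0 < p)%R by exact: lt_le_trans p1.
pose f k a := ((2 ^+ k)%:E * cut_dist (s k) (s k.+1) a) `^ p.
have f0 k a : 0 <= f k a by exact: poweR_ge0.
have c0 k : (0 <= 2 ^+ k :> R)%R by rewrite exprn_ge0.
have mc k : measurable_fun (`[0%R, 1%R] : set R) (cut_dist (s k) (s k.+1)).
  exact: measurable_cut_dist.
have mf k : measurable_fun (`[0%R, 1%R] : set R) (f k).
  by apply: measurable_poweR_itv; apply: measurable_funeM.
have fk k : \int[mu]_(a in `[0%R, 1%R]) f k a <= (2^-1 ^+ k)%:E.
  rewrite Lpnorm_itvZ//; last by move=> a; exact: cut_dist_ge0.
  have -> : \int[mu]_(a in `[0%R, 1%R]) (cut_dist (s k) (s k.+1) a `^ p) =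
      (FB_dist (s k) (s k.+1) `^ p)%:E.
    rewrite -poweR_EFin FB_distE /dp /Lpnorm_from poweRVK//.
    by apply: integral_ge0 => a _; exact: poweR_ge0.
  rewrite -EFinM lee_fin -powRM ?c0//; last by rewrite -lee_fin FB_distE dp_ge0.
  apply: (@le_trans _ _ ((2^-1 ^+ k) `^ p)%R); last first.
    apply: ge1r_powR => //; rewrite exprn_gt0 ?invr_gt0//=.
    by rewrite exprn_ile1 ?invr_ge0// invf_le1// ler1n.
  have A0 : (0 <= 2 ^+ k * FB_dist (s k) (s k.+1))%R.
    by rewrite mulr_ge0// -lee_fin FB_distE dp_ge0.
  have B0 : (0 <= 2^-1 ^+ k :> R)%R by rewrite exprn_ge0// invr_ge0.
  have AB : (2 ^+ k * FB_dist (s k) (s k.+1) <= 2^-1 ^+ k)%R.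
    have -> : (2^-1 ^+ k = 2 ^+ k * q ^+ k :> R)%R.
      by rewrite -exprMn; congr (_ ^+ _)%R; lra.
    by rewrite ler_wpM2l// ltW.
  by apply: ge0_ler_powR; rewrite ?nnegrE//; exact: ltW.
pose g a := \sum_(0 <= k <oo) f k a.
have mg : measurable_fun (`[0%R, 1%R] : set R) g.
  by apply: ge0_emeasurable_sum.
have gfin : \int[mu]_(a in `[0%R, 1%R]) g a < +oo.
  rewrite integral_nneseries//.
  apply: (@le_lt_trans _ _ (\sum_(0 <= k <oo) (2 / (2 ^ (k + 1))%:R)%:E)).
    apply: lee_nneseries => k _; first by move=> _; apply: integral_ge0.
    apply: le_trans (fk k) _; rewrite lee_fin addn1 expnS natrM invfM mulrA divff//.
    by rewrite mul1r natrX exprVn.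
  have := @cvg_geometric_eseries_half R 2 0; rewrite /eseries/= => /cvg_lim -> //.
  exact: ltry.
have ig : mu.-integrable (`[0%R, 1%R] : set R) g.
  apply/integrableP; split => //.
  by under eq_integral do rewrite gee0_abs ?nneseries_ge0//.
have gae : {ae mu, forall a, (`[0%R, 1%R]%classic : set R) a -> g a \is a fin_num}.
  exact: (integrable_ae _ ig).
apply: (@filterS _ _ (ae_filter_ringOfSetsType mu) _ _ _ gae).
move=> a + a01; rewrite /= in_itv/= a01 => /(_ isT) ga.
have fg k : f k a <= g a.
  apply: (@le_trans _ _ (\sum_(0 <= i < k.+1) f i a)).
    by rewrite big_nat_recr//= leeDr// sume_ge0.
  by apply: nneseries_lim_ge.
(* Each weighted power is at most the sum [g a], so the k-th distance at level [a] is at most C 2^-k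
   and the distances are summable. *)
pose C := (fine (g a) `^ p^-1)%R.
have C0 : (0 <= C)%R by exact: powR_ge0.
have g0 : 0 <= g a by exact: nneseries_ge0.
have Hk k : cut_dist (s k) (s k.+1) a <= (C * 2^-1 ^+ k)%:E.
  have cd0 := cut_dist_ge0 (s k) (s k.+1) a01.
  have h : (2 ^+ k)%:E * cut_dist (s k) (s k.+1) a <= C%:E.
    rewrite /C -poweR_EFin fineK// (lee_poweRV p1) ?fg//.
    by rewrite mule_ge0// lee_fin.
  have p2 : (0 < 2 ^+ k :> R)%R by rewrite exprn_gt0.
  by rewrite exprVn EFinM lee_pdivlMr// muleC.
have n0 k : alpha_cut (s k) a !=set0 by exact: cut_neq0.
have chain := @geometric_chain (fun i j => cut_dist (s i) (s j) a) C 2^-1 C0 _ _ _ Hk.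
have {}chain : forall n j, cut_dist (s n) (s (n + j)%N) a <= (2 * C * 2^-1 ^+ n)%:E.
  apply: chain.
  - by rewrite invr_ge0/=; lra.
  - by move=> n; rewrite /cut_dist hausdorffxx.
  - by move=> n k; exact: hausdorff_triangle.
move=> e e0; have [K _ KH] : \forall n \near \oo, (2 * C * 2^-1 ^+ n < e / 2)%R.
  have : ((fun n => 2 * C * 2^-1 ^+ n)%R : nat -> R) @ \oo --> (2 * C * 0 : R)%R.
    apply: cvgMr; apply: cvg_expr; rewrite ger0_norm ?invr_ge0//.
    by rewrite invf_lt1// ltr1n.
  rewrite mulr0 => /cvgrPdist_lt/(_ (e / 2)%R) H.
  have : (0 < e / 2)%R by rewrite divr_gt0.
  move=> /H; apply: filterS => n; rewrite sub0r normrN ger0_norm//.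
  by rewrite !mulr_ge0// exprn_ge0// invr_ge0.
exists K => k l Kk Kl.
have hK j : (K <= j)%N -> cut_dist (s K) (s j) a <= (2 * C * 2^-1 ^+ K)%:E.
  by move=> Kj; rewrite -(subnKC Kj).
apply: le_lt_trans (hausdorff_triangle (n0 k) (n0 K) (n0 l)) _.
rewrite hausdorffC; apply: le_lt_trans (leeD (hK k Kk) (hK l Kl)) _.
by rewrite -EFinD lte_fin (splitr e); have := KH K (leqnn K); lra.
Qed.

End rapidly_cauchy.

(** * Completeness of the four subspaces and the equivalences *)

Lemma rapid_limit (R : realType) (m : nat) (p : R) (p1 : 1 <= p)
    (X : set (FBspace m p1))
    (hX : [\/ X = cut_star_shaped, X = fuzzy_convex, X = star_shaped0
            | X = star_shaped])
    (s : nat -> FBspace m p1) :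
  (forall n, X (s n)) -> (forall n, FB_dist (s n) (s n.+1) < 4^-1 ^+ n) ->
  exists2 u, X u & forall n, FB_dist u (s n) <= 2 * 4^-1 ^+ n.
Proof.
(* Every term is within 2 of [s 0], which bounds all the norms. *)
move=> sX rs; pose M := 2 + fine (Lpnorm_itv p 0 1 (cut_norm (s 0%N))).
have sM k : (Lpnorm_itv p 0 1 (cut_norm (s k)) <= M%:E)%E.
  apply: le_trans (cut_norm_dist_le (s 0%N) (s k)) _; rewrite /M EFinD.
  rewrite fineK ?ge0_fin_numE ?Lpnorm_itv_ge0 ?cut_norm_lty//.
  rewrite leeD2r// -FB_distE lee_fin.
  by apply: le_trans (rapid_FB_dist rs (leq0n k)) _; rewrite expr0 mulr1.
have cs := rapid_cauchy_cut rs.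
exists (limit_fuzzy sM cs).
  case: hX => EX; rewrite EX in sX *.
  - exact: limit_cut_star_shaped.
  - exact: limit_fuzzy_convex.
  - exact: limit_star_shaped0.
  - exact: limit_star_shaped.
move=> n; rewrite -lee_fin FB_distE /dp.
have -> : (fun a => hausdorff_dist (alpha_cut (limit_fuzzy sM cs) a) (alpha_cut (s n) a)) =
    (fun a => hausdorff_dist (alpha_cut (s n) a) (alpha_cut (limit_fuzzy sM cs) a)).
  by apply/funext => a; rewrite hausdorffC.
apply: limit_dp; exists n => k nk.
by rewrite -FB_distE lee_fin; exact: rapid_FB_dist.
Qed.

Theorem theorem6p12 (R : realType) (m : nat) (p : R)
    (m1 : (1 <= m)%N) (p1 : 1 <= p) (X : set (FBspace m p1))
    (hX : [\/ X = cut_star_shaped, X = fuzzy_convex, X = star_shaped0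
            | X = star_shaped])
    (U : set X) :
  (totally_bounded U <-> compact (closure U)) /\
  (compact (closure U) <->
     mean_bounded (set_val @` U) /\ mean_equi_left_continuous (set_val @` U)).
Proof.
have tc : totally_bounded U -> compact (closure U).
  (* The ratio 1 / 4 is the rate for which limits in [X] have been constructed. *)
  apply: (@totally_bounded_compact_closure _ _ _ 4^-1).
    by rewrite invr_gt0/= invf_lt1// ltr1n ltr0n.
  move=> s sb; have [n||u Xu us] := @rapid_limit _ _ _ _ X hX (fun n => set_val (s n)).
  - exact: set_valP.
  - exact: sb.
  exists (SigSub (mem_set Xu)) => e e0.
  have [K _ KH] : \forall n \near \oo, `|0 - 2 * 4^-1 ^+ n| < e.
    have : ((fun n => 2 * 4^-1 ^+ n) : nat -> R) @ \oo --> (2 * 0 : R).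
      apply: cvgMr; apply: cvg_expr; rewrite ger0_norm ?invr_ge0//.
      by rewrite invf_lt1// ltr1n.
    by rewrite mulr0 => /cvgrPdist_lt/(_ e e0).
  exists K => n /KH /=; rewrite sub0r normrN => H.
  exact: le_lt_trans (us n) (le_lt_trans (ler_norm _) H).
have ct : compact (closure U) -> totally_bounded U.
  move=> /compact_totally_bounded cU e /cU[F fF UF]; exists F => //.
  exact: subset_trans (@subset_closure _ U) UF.
split; first by split.
split=> [/ct tU|[bU lU]].
  have tV : totally_bounded (set_val @` U).
    move=> e /tU[F fF UF]; exists (set_val @` F); first exact: finite_image.
    by move=> _ [x /UF[c Fc cx] <-]; exists (set_val c) => //; exists c.
  by split; [exact: totally_bounded_mean_bounded|exact: totally_bounded_equi_left_continuous].
apply: tc => e e0.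
have [F [fF FU] UF] := mean_conditions_net bU lU e0.
(* The centres lie in the image of [U], so they pull back to a finite set of points of the subspace
   [X]. *)
have [G fG GF] : exists2 G : set X, finite_set G & F `<=` set_val @` G.
  exists (set_val @^-1` F); last by move=> c /[dup] Fc /FU[x Ux xc]; exists x => //=; rewrite xc.
  by apply: finite_preimage => // x y _ _; exact: val_inj.
exists G => // x Ux; have [|_ /GF[c Gc <-] cx] := UF (set_val x); first by exists x.
exists c => //; change (FB_dist (set_val c) (set_val x) < e).
by rewrite -lte_fin FB_distE.
Qed.
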